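(* The following hidden problems with $\{\mathcal V\}$-revealing oracle are solvable in polynomial time: (a) $\mathrm{H}(2\text{-}\mathrm{SAT})_{\{\mathcal V\}}$; (b) $\mathrm{H}(\mathrm{UG}_2)_{\{\mathcal V\}}$; (c) $\mathrm{H}(S_{\mathcal P})_{\{\mathcal V\}}$ for every graph property $\mathcal P$ whose associated CSP $S_{\mathcal P}$ is solvable in polynomial time; (d) $\mathrm{H}(\mathrm{EQ}_{\mathrm{ST}})_{\{\mathcal V\}}$.
   Context: CSP framework: a CSP $S$ is given, for each $n$, by alphabet $\{0,\dots,w-1\}$, assignment length $\ell$, a set $W\subseteq\{0,\dots,w-1\}^\ell$ of admissible assignments, arity $q$, and a type $\mathcal R$ of $q$-ary relations; an instance is a set of $m$ constraints $R(x_{j_1},\dots,x_{j_q})$ ($R\in\mathcal R$, pairwise distinct indices $j_1,\dots,j_q\in\{1,\dots,\ell\}$); a solution is an $a\in W$ with $(a_{j_1},\dots,a_{j_q})\in R$ for all constraints, or ''no'' if none exists. The hidden problem $\mathrm{H}(S)_{\{\mathcal V\}}$: the algorithm knows the parameters, type, $n$ and $m$, but the instance is accessible only through an oracle which, on a query $a\in W$, answers ''yes'' if $a$ satisfies all constraints and otherwise returns the index $j$ of some (arbitrarily chosen) violated constraint $C_j=R(x_{j_1},\dots,x_{j_q})$ together with $(j_1,\dots,j_q)$ (but not $R$); the algorithm must output a satisfying assignment if one exists and ''no'' otherwise, for every instance and such oracle; each query counts as one step. 2-SAT: $w=2$, $q=2$, $W=\{0,1\}^\ell$, type consisting of the ten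 binary relations given by the Boolean functions of $(\alpha,\beta)$: constant true, constant false, $\alpha$, $\beta$, $\neg\alpha$, $\neg\beta$, $\alpha\vee\beta$, $\alpha\vee\neg\beta$, $\neg\alpha\vee\beta$, $\neg\alpha\vee\neg\beta$. $\mathrm{UG}_k$ (exact unique games): $w=k$, $q=2$, $W=\{0,\dots,k-1\}^\ell$, type consisting of the relations $\{(\alpha,\pi(\alpha)):\alpha\}$ for all permutations $\pi$ of $\{0,\dots,k-1\}$. Graph property CSP $S_{\mathcal P}$ for a monotone graph property $\mathcal P$ of $n$-vertex graphs: $w=2$, $q=1$, $\ell=\binom n2$ (variables = possible edges), $W$ = the graphs with a minimal number of edges satisfying $\mathcal P$, type $\{\mathsf{Neg}\}$ with $\mathsf{Neg}=\{0\}$; a graph $G=(V,E)$ gives the instance with constraints $\mathsf{Neg}(x_e)$ for $e\notin E$. $\mathrm{EQ}_{\mathcal K}$ for a class $\mathcal K$ of graphs on $n$ vertices: $w=2$, $q=1$, $\ell=\binom n2$, $W=\mathcal K$ (graphs as characteristic vectors of edge sets), type $\{\mathsf{Id},\mathsf{Neg}\}$ with $\mathsf{Id}=\{1\}$, $\mathsf{Neg}=\{0\}$; $\mathrm{EQ}_{\mathrm{ST}}$ is $\mathrm{EQ}_{\mathcal K}$ with $\mathcal K$ the set of spanning trees on $n$ vertices. *)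

(* Defs.v *)
From mathcomp Require Import all_boot all_fingroup.

Set Implicit Arguments.
Unset Strict Implicit.
Unset Printing Implicit Defensive.

(* The machine model is the WHILE language over binary trees (N. D. Jones,
   "Computability and Complexity", 1997), extended by oracle queries.  Its unit
   cost measure defines the usual class of polynomial time computations: with
   shared subtrees, all values present after t steps form a DAG with O(s + t)
   nodes, where s is the size of the input, and every step is a bounded number
   of pointer operations on that DAG. *)

Inductive tree := Leaf | Node of tree & tree.

Definition hd t := if t is Node l _ then l else Leaf.
Definition tl t := if t is Node _ r then r else Leaf.
Definition nonleaf t := if t is Node _ _ then true else false.

Inductive expr :=
  | EVar of nat
  | ELeaf
  | ENode of expr & expr
  | EHd of expr
  | ETl of expr.

(* [Call x p e] runs [p] as a procedure: in a private store whose variable 0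
   holds the value of [e] and whose other variables hold [Leaf]; the final value
   of its variable 0 is assigned to [x].  Procedures cannot be recursive. *)
Inductive prog :=
  | Assign of nat & expr
  | Seq of prog & prog
  | If of expr & prog & prog
  | While of expr & prog
  | Call of nat & prog & expr
  | Query of nat & expr.

Definition store := nat -> tree.
Definition upd (s : store) x v : store := fun y => if y == x then v else s y.
Definition init v : store := upd (fun=> Leaf) 0 v.

Fixpoint eval (s : store) e :=
  match e with
  | EVar x => s x
  | ELeaf => Leaf
  | ENode e1 e2 => Node (eval s e1) (eval s e2)
  | EHd e1 => hd (eval s e1)
  | ETl e1 => tl (eval s e1)
  end.

(* [O k q r]: the query [q], asked after [k] earlier queries, is admissible and
   is answered by [r].  Since programs are deterministic, letting the answer
   depend on [k] accounts for all adaptive oracles.  An inadmissible query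
   blocks the execution. *)
Definition oracle := nat -> tree -> tree -> Prop.

Definition no_oracle : oracle := fun _ _ _ => False.

(* [exec O k s p k' s' t]: started in store [s] after [k] queries, [p]
   terminates after [t] steps in store [s'], at which point [k'] queries have
   been made.  Expressions are part of the program text, so that charging one
   step for evaluating an expression changes running times by a constant factor
   only. *)
Inductive exec (O : oracle) : nat -> store -> prog -> nat -> store -> nat -> Prop :=
  | exec_assign k s x e :
      exec O k s (Assign x e) k (upd s x (eval s e)) 1
  | exec_seq k s p1 k1 s1 t1 p2 k2 s2 t2 :
      exec O k s p1 k1 s1 t1 -> exec O k1 s1 p2 k2 s2 t2 ->
      exec O k s (Seq p1 p2) k2 s2 (t1 + t2)
  | exec_if k s e p1 p2 k' s' t :
      exec O k s (if nonleaf (eval s e) then p1 else p2) k' s' t ->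
      exec O k s (If e p1 p2) k' s' t.+1
  | exec_while_stop k s e p :
      ~~ nonleaf (eval s e) ->
      exec O k s (While e p) k s 1
  | exec_while_step k s e p k1 s1 t1 k2 s2 t2 :
      nonleaf (eval s e) ->
      exec O k s p k1 s1 t1 -> exec O k1 s1 (While e p) k2 s2 t2 ->
      exec O k s (While e p) k2 s2 (t1 + t2).+1
  | exec_call k s x p e k' s' t :
      exec O k (init (eval s e)) p k' s' t ->
      exec O k s (Call x p e) k' (upd s x (s' 0)) t.+1
  | exec_query k s x e r :
      O k (eval s e) r ->
      exec O k s (Query x e) k.+1 (upd s x r) 1.

Definition runs (O : oracle) (p : prog) (inp out : tree) (t : nat) :=
  exists k s, exec O 0 (init inp) p k s t /\ s 0 = out.

Lemma exec_det (O : oracle) :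
  (forall k q r r', O k q r -> O k q r' -> r = r') ->
  forall k s p k1 s1 t1, exec O k s p k1 s1 t1 ->
  forall k2 s2 t2, exec O k s p k2 s2 t2 -> [/\ k1 = k2, s1 = s2 & t1 = t2].
Proof.
move=> fO k s p k1 s1 t1; elim=> {k s p k1 s1 t1}.
- by move=> k s x e k2 s2 t2 E; inversion E.
- move=> k s p1 k1 s1 t1 p2 k2 s2 t2 _ IH1 _ IH2 k3 s3 t3 E.
  inversion E as [|? ? ? ? ? ? ? ? ? ? E1 E2| | | | |]; subst.
  have [? ? ?] := IH1 _ _ _ E1; subst.
  by have [-> -> ->] := IH2 _ _ _ E2.
- move=> k s e p1 p2 k' s' t _ IH k2 s2 t2 E.
  inversion E as [| |? ? ? ? ? ? ? ? E1| | | |]; subst.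
  by have [-> -> ->] := IH _ _ _ E1.
- move=> k s e p /negbTE st k2 s2 t2 E.
  inversion E as [| | | |? ? ? ? ? ? ? ? ? ? st'| |]; subst => //.
  by rewrite st in st'.
- move=> k s e p k1 s1 t1 k2 s2 t2 st _ IH1 _ IH2 k3 s3 t3 E.
  inversion E as [| | |? ? ? ? st'|? ? ? ? ? ? ? ? ? ? st' E1 E2| |]; subst.
    by rewrite st in st'.
  have [? ? ?] := IH1 _ _ _ E1; subst.
  by have [-> -> ->] := IH2 _ _ _ E2.
- move=> k s x p e k' s' t _ IH k2 s2 t2 E.
  inversion E as [| | | | |? ? ? ? ? ? ? ? E1|]; subst.
  by have [-> -> ->] := IH _ _ _ E1.
- move=> k s x e r Or k2 s2 t2 E.
  inversion E as [| | | | | |? ? ? ? ? Or']; subst.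
  by rewrite (fO _ _ _ _ Or Or').
Qed.

(* Numbers are encoded in unary. *)
Definition enc_nat (k : nat) : tree := iter k (Node Leaf) Leaf.
Definition enc_seq (s : seq tree) : tree := foldr Node Leaf s.
Definition enc_opt (o : option tree) : tree :=
  if o is Some t then Node Leaf t else Leaf.
Definition enc_tuple (k w : nat) (a : k.-tuple 'I_w) : tree :=
  enc_seq [seq enc_nat i | i : 'I_w <- a].

(* The parameters of a CSP for one value of n.  Variables are numbered from 0. *)
Record csp_at := CSPAt {
  alph : nat;
  len : nat;
  arity : nat;
  adm : len.-tuple 'I_alph -> Prop;
  rels : seq {set arity.-tuple 'I_alph} }.

Definition csp := nat -> csp_at.

Section CSP.
Implicit Types S : csp_at.

Definition assignment S : Type := (len S).-tuple 'I_(alph S).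

Definition constraint S : eqType :=
  ({set (arity S).-tuple 'I_(alph S)} * (arity S).-tuple 'I_(len S))%type.

Definition wf_constraint S (c : constraint S) : bool :=
  (c.1 \in rels S) && uniq c.2.

Definition satisfies S (a : assignment S) (c : constraint S) : bool :=
  [tuple of [seq tnth a j | j <- c.2]] \in c.1.

(* The set of m constraints is numbered, hence the distinctness condition. *)
Definition is_instance S m (I : m.-tuple (constraint S)) : bool :=
  all (@wf_constraint S) I && uniq I.

Definition solution S m (I : m.-tuple (constraint S)) (a : assignment S) : Prop :=
  adm a /\ all (satisfies a) I.

Definition correct_output S m (I : m.-tuple (constraint S))
    (o : option (assignment S)) : Prop :=
  if o is Some a then solution I a else forall a, ~ solution I a.

Definition enc_output S (o : option (assignment S)) : tree :=
  enc_opt (omap (@enc_tuple _ _) o).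

Definition enc_params S (n m : nat) : seq tree :=
  [seq enc_nat i | i <- [:: n; m; alph S; len S; arity S]].

(* A relation is encoded by its position in the type. *)
Definition enc_constraint S (c : constraint S) : tree :=
  Node (enc_nat (index c.1 (rels S))) (enc_tuple c.2).

Definition enc_instance S m (I : m.-tuple (constraint S)) : tree :=
  enc_seq [seq enc_constraint c | c <- I].

(* [None] is the answer "yes"; [Some (j, v)] reports the violated constraint
   number j together with its tuple v of variables. *)
Definition answer S m : Type := option ('I_m * (arity S).-tuple 'I_(len S)).

Definition enc_answer S m (r : answer S m) : tree :=
  if r is Some (j, v) then Node (enc_nat j) (enc_tuple v) else Leaf.

(* [O k a] is the answer to the query [a] when [k] queries were made before. *)
Definition V_oracle S m (I : m.-tuple (constraint S))
    (O : nat -> assignment S -> answer S m) : Prop :=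
  forall k a, adm a ->
    if O k a is Some (j, v)
    then ~~ satisfies a (tnth I j) /\ v = (tnth I j).2
    else all (satisfies a) I.

Definition oracle_of S m (O : nat -> assignment S -> answer S m) : oracle :=
  fun k q r => exists a : assignment S,
    [/\ adm a, q = enc_tuple a & r = enc_answer (O k a)].

End CSP.

Definition poly_solvable (S : csp) : Prop :=
  exists (p : prog) (c d : nat),
  forall (n m : nat) (I : m.-tuple (constraint (S n))), is_instance I ->
  exists (o : option (assignment (S n))) (t : nat),
    [/\ runs no_oracle p (enc_seq (rcons (enc_params (S n) n m) (enc_instance I)))
          (enc_output o) t,
        correct_output I o & t <= c * (n + m) ^ d + c].

Definition hidden_poly_solvable (S : csp) : Prop :=
  exists (p : prog) (c d : nat),
  forall (n m : nat) (I : m.-tuple (constraint (S n))), is_instance I ->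
  forall O : nat -> assignment (S n) -> answer (S n) m, V_oracle I O ->
  exists (o : option (assignment (S n))) (t : nat),
    [/\ runs (oracle_of O) p (enc_seq (enc_params (S n) n m)) (enc_output o) t,
        correct_output I o & t <= c * (n + m) ^ d + c].

Definition bool_rel (f : bool -> bool -> bool) : {set 2.-tuple 'I_2} :=
  [set x | f (tnth x ord0 == ord_max) (tnth x ord_max == ord_max)].

Definition two_sat : csp := fun n =>
  @CSPAt 2 n 2 (fun=> True)
    [seq bool_rel f | f <-
      [:: (fun _ _ => true); (fun _ _ => false);
          (fun a _ => a); (fun _ b => b); (fun a _ => ~~ a); (fun _ b => ~~ b);
          (fun a b => a || b); (fun a b => a || ~~ b);
          (fun a b => ~~ a || b); (fun a b => ~~ a || ~~ b)]].

Definition unique_games (k : nat) : csp := fun n =>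
  @CSPAt k n 2 (fun=> True)
    [seq [set [tuple x; s x] | x : 'I_k] | s : {perm 'I_k}].

Definition Neg : {set 1.-tuple 'I_2} := [set [tuple ord0]].
Definition Id : {set 1.-tuple 'I_2} := [set [tuple ord_max]].

(* A graph on n vertices is given by its set of edges, which are 2-sets. *)
Definition graph (n : nat) : Type := {set {set 'I_n}}.

Definition simple n (G : graph n) : Prop := forall e, e \in G -> #|e| = 2.

(* The possible edge {i, j}, i < j, is variable number 'C(j, 2) + i; this is a
   bijection onto {0, ..., 'C(n, 2) - 1}. *)
Definition edge_var (i j : nat) : nat := 'C(j, 2) + i.

Lemma edge_var_lt n i j : i < j -> j < n -> edge_var i j < 'C(n, 2).
Proof.
move=> ij jn; apply: (@leq_trans 'C(j.+1, 2)); last first.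
  by apply: leq_bin2l.
by rewrite /edge_var binS bin1 -addnS leq_add2l.
Qed.

Lemma edge_var_inj i j i' j' : i < j -> i' < j' ->
  edge_var i j = edge_var i' j' -> i = i' /\ j = j'.
Proof.
move=> ij ij' E; have jj' : j = j'.
  case: (ltngtP j j') => // jj; suff: false by [].
    by have := edge_var_lt ij jj; rewrite E /edge_var -{2}['C(j', 2)]addn0 ltn_add2l.
  by have := edge_var_lt ij' jj; rewrite -E /edge_var -{2}['C(j, 2)]addn0 ltn_add2l.
by move: E; rewrite /edge_var jj' => /addnI.
Qed.

Definition graph_of n (a : 'C(n, 2).-tuple 'I_2) : graph n :=
  [set [set p.1; p.2] | p : 'I_n * 'I_n &
     (p.1 < p.2) && (nth ord0 a (edge_var p.1 p.2) == ord_max)].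

Definition property : Type := forall n : nat, graph n -> Prop.

Definition monotone_graph_property (P : property) : Prop :=
  forall n (G : graph n), simple G ->
    (forall s : {perm 'I_n}, P n [set s @: e | e : {set 'I_n} in G] <-> P n G) /\
    (forall H : graph n, simple H -> G \subset H -> P n G -> P n H).

(* "With a minimal number of edges" may be read in two ways: no graph with the
   property has fewer edges, or no edge can be removed. *)
Definition fewest_edges (P : property) : property := fun n G =>
  P n G /\ forall H : graph n, simple H -> P n H -> #|G| <= #|H|.

Definition edge_minimal (P : property) : property := fun n G =>
  P n G /\ forall H : graph n, H \proper G -> ~ P n H.

Definition graph_csp (W : property) (R : seq {set 1.-tuple 'I_2}) : csp := fun n =>
  @CSPAt 2 'C(n, 2) 1 (fun a => W n (graph_of a)) R.

Definition S_fewest (P : property) : csp := graph_csp (fewest_edges P) [:: Neg].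
Definition S_minimal (P : property) : csp := graph_csp (edge_minimal P) [:: Neg].

Definition EQ (K : property) : csp := graph_csp K [:: Id; Neg].

Definition adj n (G : graph n) : rel 'I_n := fun i j => [set i; j] \in G.

Definition spanning_tree : property := fun n G =>
  (forall i j, connect (adj G) i j) /\
  (forall c : seq 'I_n, ucycle (adj G) c -> size c <= 2).

(* Main.v *)
Require Import Defs.
From mathcomp Require Import all_boot all_fingroup zify.

(* A violated constraint is reported together with its variables, so each query
   [a] excludes one local assignment (the restriction of [a] to these variables)
   for the reported constraint.  If every query is compatible with all the
   exclusions learned so far, then each query yields a new pair (constraint,
   excluded local assignment), hence there are at most m * w^q + 1 queries.  It
   remains to find in polynomial time an admissible assignment compatible with
   the exclusions, or to see that there is none:
   - for w = q = 2 the exclusions form a 2-CNF formula, whatever the relations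
     are; this covers both 2-SAT and UG_2;
   - for S_P the exclusions are themselves an instance of S_P;
   - for EQ_ST the exclusions prescribe some edges and forbid others, and
     Kruskal's algorithm, fed with the prescribed edges first, finds a suitable
     spanning tree. *)

Set Implicit Arguments.
Unset Strict Implicit.
Unset Printing Implicit Defensive.

(** * Polynomial bounds, normalised to a single power of N + 2 *)

(** Polynomial time has to be certified for concrete programs. To this end the solvers are written
    as list functions on data whose types do not depend on [n] or [m], and their running time
    follows from closure properties of the class [ptime]; the delicate closure is that under folds,
    where the accumulator must stay polynomial through all rounds. Each round is one-sided. A
    solution of the hidden instance never restricts to an excluded local assignment, so the lack of
    a compatible assignment justifies the answer no; a compatible candidate may still be wrong, but
    then the oracle extends the history. The solvers for 2-SAT and for trees test their result
    against the exclusions, so only completeness needs theory: conflicts are closed under resolution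
    in the first case, and Kruskal's algorithm rejects an edge only if it closes a cycle with
    accepted edges in the second. For S_P the exclusions must form a set of distinct constraints;
    they do, because a violated [Neg] can exclude the value 1 only, so that no constraint is
    reported twice. *)

Lemma leq_exp_const N a : a <= N.+2 ^ a.
Proof. by rewrite ltnW // ltn_expl. Qed.

Lemma leq_exp_var N : N <= N.+2 ^ 1.
Proof. by rewrite expn1 -addn2 leq_addr. Qed.

Lemma leq_exp_weak N a b x : a <= b -> x <= N.+2 ^ a -> x <= N.+2 ^ b.
Proof. by move=> ab xa; apply: leq_trans xa _; rewrite leq_pexp2l. Qed.

Lemma leq_exp_mul N a b x y :
  x <= N.+2 ^ a -> y <= N.+2 ^ b -> x * y <= N.+2 ^ (a + b).
Proof. by move=> xa yb; rewrite expnD leq_mul. Qed.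

(** The base is at least 2, so one extra factor absorbs the doubling. Constants are absorbed
    likewise, which lets a bare exponent serve as the whole bound. *)
Lemma leq_exp_add N a b x y :
  x <= N.+2 ^ a -> y <= N.+2 ^ b -> x + y <= N.+2 ^ (a + b).+1.
Proof.
move=> xa yb; rewrite expnS.
apply: (@leq_trans (2 * N.+2 ^ (a + b))); last by rewrite leq_mul.
rewrite mul2n -addnn leq_add //.
  by apply: leq_exp_weak xa; rewrite leq_addr.
by apply: leq_exp_weak yb; rewrite leq_addl.
Qed.

Lemma leq_exp_comp N a b x y :
  x <= N.+2 ^ a -> y <= x.+2 ^ b -> y <= N.+2 ^ ((a + 2).+1 * b).
Proof.
move=> xa yb; apply: leq_trans yb _; rewrite expnM.
case: b => [//|b]; rewrite leq_exp2r // -addn2.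
by apply: leq_exp_add xa _; apply: leq_exp_const.
Qed.
Fixpoint tsize (t : tree) : nat :=
  if t is Node l r then (tsize l + tsize r).+1 else 1.

(** * Executions without queries *)

(** Quantifying over the oracle and the query count lets a query-free computation be called at any
    moment of the query loop. *)
Definition ev (s : store) (p : prog) (s' : store) (t : nat) : Prop :=
  forall O k, exec O k s p k s' t.

Definition computes (p : prog) (x y : tree) (t : nat) : Prop :=
  exists2 s, ev (init x) p s t & s 0 = y.

Lemma ev_assign s x e : ev s (Assign x e) (upd s x (eval s e)) 1.
Proof. by move=> O k; constructor. Qed.

Lemma ev_seq s p1 s1 t1 p2 s2 t2 :
  ev s p1 s1 t1 -> ev s1 p2 s2 t2 -> ev s (Seq p1 p2) s2 (t1 + t2).
Proof. by move=> E1 E2 O k; apply: exec_seq (E1 O k) (E2 O k). Qed.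

Lemma ev_if s e p1 p2 s' t :
  ev s (if nonleaf (eval s e) then p1 else p2) s' t -> ev s (If e p1 p2) s' t.+1.
Proof. by move=> E O k; apply: exec_if. Qed.

Lemma ev_while_stop s e p : ~~ nonleaf (eval s e) -> ev s (While e p) s 1.
Proof. by move=> E O k; apply: exec_while_stop. Qed.

Lemma ev_while_step s e p s1 t1 s2 t2 : nonleaf (eval s e) ->
  ev s p s1 t1 -> ev s1 (While e p) s2 t2 -> ev s (While e p) s2 (t1 + t2).+1.
Proof.
by move=> E E1 E2 O k; apply: exec_while_step (E1 O k) (E2 O k).
Qed.

Lemma ev_call s x p e y t :
  computes p (eval s e) y t -> ev s (Call x p e) (upd s x y) t.+1.
Proof. by case=> s' E <- O k; apply: exec_call. Qed.

(** * Encodings of data, and polynomial bounds relative to a measure *)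

Class encodable (A : Type) := enc : A -> tree.

#[global] Instance encodable_tree : encodable tree := id.
#[global] Instance encodable_nat : encodable nat := enc_nat.
(** [true] becomes a nonleaf and [false] a leaf, so a Boolean can be tested by [If] directly. *)
#[global] Instance encodable_bool : encodable bool := fun b => enc_nat b.
#[global] Instance encodable_prod A B `{encodable A} `{encodable B} :
  encodable (A * B) := fun x => Node (enc x.1) (enc x.2).
#[global] Instance encodable_seq A `{encodable A} : encodable (seq A) :=
  fun s => enc_seq (map enc s).
#[global] Instance encodable_option A `{encodable A} : encodable (option A) :=
  fun o => enc_opt (omap enc o).

Definition dsize {A} `{encodable A} (x : A) : nat := tsize (enc x).

(** The measure [N] is a parameter because bounds are needed both in the size of an argument and in
    [n + m], and have to be chained. *)
Definition pbounded T (N g : T -> nat) : Prop :=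
  exists c, forall x, g x <= (N x).+2 ^ c.

Section PBounded.
Variables (T : Type) (N : T -> nat).

Lemma pbounded_le g h : pbounded N h -> (forall x, g x <= h x) -> pbounded N g.
Proof. by case=> c hc gh; exists c => x; apply: leq_trans (hc x). Qed.

Lemma pbounded_const a : pbounded N (fun=> a).
Proof. by exists a => x; apply: leq_exp_const. Qed.

Lemma pbounded_id : pbounded N N.
Proof. by exists 1 => x; apply: leq_exp_var. Qed.

Lemma pbounded_add g h :
  pbounded N g -> pbounded N h -> pbounded N (fun x => g x + h x).
Proof.
by move=> [a ha] [b hb]; exists (a + b).+1 => x; apply: leq_exp_add.
Qed.

Lemma pbounded_mul g h :
  pbounded N g -> pbounded N h -> pbounded N (fun x => g x * h x).
Proof.
by move=> [a ha] [b hb]; exists (a + b) => x; apply: leq_exp_mul.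
Qed.

Lemma pbounded_comp g h : pbounded N g -> pbounded g h -> pbounded N h.
Proof.
move=> [a ha] [b hb]; exists ((a + 2).+1 * b) => x.
exact: leq_exp_comp (ha x) (hb x).
Qed.

Lemma pbounded_S g : pbounded N g -> pbounded N (fun x => (g x).+1).
Proof.
move=> hg; apply: (pbounded_le (pbounded_add (pbounded_const 1) hg)) => x.
by rewrite add1n.
Qed.

End PBounded.

(** * Polynomial time functions *)

(* [ptime] also bounds the size of the result, since unlike running times tree
   sizes may grow exponentially under sharing; this makes [ptime] closed under
   composition. *)
Definition ptime {A B} `{encodable A} `{encodable B} (f : A -> B) : Prop :=
  exists (p : prog) (tm : A -> nat),
  [/\ forall x, computes p (enc x) (enc (f x)) (tm x),
      pbounded dsize tm & pbounded dsize (fun x => dsize (f x))].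

Lemma pbounded_pull A B (M : B -> nat) (f : A -> B) (g : B -> nat) :
  pbounded M g -> pbounded (fun x => M (f x)) (fun x => g (f x)).
Proof. by case=> c hc; exists c => x; apply: hc. Qed.

Lemma ptime_ext A B `{encodable A} `{encodable B} (f g : A -> B) :
  f =1 g -> ptime f -> ptime g.
Proof.
move=> fg [p [t [h1 h2 h3]]]; exists p, t; split=> //.
  by move=> x; rewrite -fg.
by case: h3 => c hc; exists c => x; rewrite -fg.
Qed.

Lemma ptime_expr A B `{encodable A} `{encodable B} e (f : A -> B) :
  (forall x, eval (init (enc x)) e = enc (f x)) ->
  pbounded dsize (fun x => dsize (f x)) -> ptime f.
Proof.
move=> E hs; exists (Assign 0 e), (fun=> 1); split=> //.
  move=> x; exists (upd (init (enc x)) 0 (enc (f x))) => //.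
  by rewrite -E; apply: ev_assign.
exact: pbounded_const.
Qed.

Lemma ptime_id A `{encodable A} : ptime (fun x : A => x).
Proof. by apply: (@ptime_expr _ _ _ _ (EVar 0)) => //; apply: pbounded_id. Qed.

Lemma ptime_comp A B C `{encodable A} `{encodable B} `{encodable C}
    (g : B -> C) (f : A -> B) :
  ptime g -> ptime f -> ptime (fun x => g (f x)).
Proof.
move=> [q [tq [q1 q2 q3]]] [p [tp [p1 p2 p3]]].
exists (Seq (Call 0 p (EVar 0)) (Call 0 q (EVar 0))).
exists (fun x => (tp x).+1 + (tq (f x)).+1); split.
- move=> x; eexists; first (apply: ev_seq; apply: ev_call).
  + exact: p1.
  + exact: q1.
  by [].
- apply: pbounded_add; apply: pbounded_S => //.
  by apply: pbounded_comp p3 _; apply: (pbounded_pull _ q2).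
- by apply: pbounded_comp p3 _; apply: (pbounded_pull _ q3).
Qed.

Lemma ptime_pair A B C `{encodable A} `{encodable B} `{encodable C}
    (f : A -> B) (g : A -> C) :
  ptime f -> ptime g -> ptime (fun x => (f x, g x)).
Proof.
move=> [p [tp [p1 p2 p3]]] [q [tq [q1 q2 q3]]].
exists (Seq (Call 1 p (EVar 0)) (Seq (Call 2 q (EVar 0))
         (Assign 0 (ENode (EVar 1) (EVar 2))))).
exists (fun x => (tp x).+1 + ((tq x).+1 + 1)); split.
- move=> x; eexists.
    apply: ev_seq; first (apply: ev_call; exact: p1).
    apply: ev_seq; first (apply: ev_call; exact: q1).
    exact: ev_assign.
  by [].
- apply: pbounded_add; first exact: pbounded_S.
  by apply: pbounded_add; [apply: pbounded_S | apply: pbounded_const].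
- by apply: pbounded_S; apply: pbounded_add.
Qed.

Lemma ptime_comp2 A B C D `{encodable A} `{encodable B} `{encodable C} `{encodable D}
    (h : B -> C -> D) (f : A -> B) (g : A -> C) :
  ptime (fun w : B * C => h w.1 w.2) -> ptime f -> ptime g ->
  ptime (fun x => h (f x) (g x)).
Proof.
by move=> ph pf pg; apply: (ptime_comp ph (f := fun x => (f x, g x)) (ptime_pair _ _)).
Qed.

Lemma ptime_fst A B `{encodable A} `{encodable B} : ptime (fun x : A * B => x.1).
Proof.
apply: (@ptime_expr _ _ _ _ (EHd (EVar 0))) => //.
by apply: (pbounded_le (pbounded_id _)) => -[a b]; rewrite /dsize /=; lia.
Qed.

Lemma ptime_snd A B `{encodable A} `{encodable B} : ptime (fun x : A * B => x.2).
Proof.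
apply: (@ptime_expr _ _ _ _ (ETl (EVar 0))) => //.
by apply: (pbounded_le (pbounded_id _)) => -[a b]; rewrite /dsize /=; lia.
Qed.

Fixpoint expr_of (t : tree) : expr :=
  if t is Node l r then ENode (expr_of l) (expr_of r) else ELeaf.

Lemma eval_expr_of s t : eval s (expr_of t) = t.
Proof. by elim: t => //= l -> r ->. Qed.

Lemma ptime_const A B `{encodable A} `{encodable B} (b : B) : ptime (fun _ : A => b).
Proof.
apply: (@ptime_expr _ _ _ _ (expr_of (enc b))).
  by move=> x; rewrite eval_expr_of.
exact: pbounded_const.
Qed.

Lemma ptime_if A B `{encodable A} `{encodable B} (b : A -> bool) (f g : A -> B) :
  ptime b -> ptime f -> ptime g -> ptime (fun x => if b x then f x else g x).
Proof.
move=> [r [tr [r1 r2 r3]]] [p [tp [p1 p2 p3]]] [q [tq [q1 q2 q3]]].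
exists (Seq (Call 1 r (EVar 0))
  (If (EVar 1) (Call 0 p (EVar 0)) (Call 0 q (EVar 0)))).
exists (fun x => (tr x).+1 + (if b x then (tp x).+1 else (tq x).+1).+1); split.
- move=> x; exists (upd (upd (init (enc x)) 1 (enc (b x))) 0
      (enc (if b x then f x else g x))) => //.
  apply: ev_seq; first (apply: ev_call; exact: r1).
  apply: ev_if; rewrite /=.
  have -> : upd (init (enc x)) 1 (enc (b x)) 1 = enc (b x) by [].
  by case: (b x); apply: ev_call; [apply: p1 | apply: q1].
- apply: pbounded_add; first exact: pbounded_S.
  apply: pbounded_S.
  apply: (pbounded_le (pbounded_add (pbounded_S p2) (pbounded_S q2))) => x.
  by case: (b x); lia.
- by apply: (pbounded_le (pbounded_add p3 q3)) => x; case: (b x); lia.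
Qed.

Lemma dsize_cons A `{encodable A} (y : A) l : dsize (y :: l) = (dsize y + dsize l).+1.
Proof. by []. Qed.

Lemma dsize_pair A B `{encodable A} `{encodable B} (x : A) (y : B) :
  dsize (x, y) = (dsize x + dsize y).+1.
Proof. by []. Qed.

Lemma dsize_nat (n : nat) : dsize n = (2 * n).+1.
Proof. by elim: n => // n IH; have -> : dsize n.+1 = (dsize n).+2 by []; lia. Qed.

Lemma dsize_bool (b : bool) : dsize b <= 3.
Proof. by case: b. Qed.

Lemma size_dsize A `{encodable A} (l : seq A) : size l <= dsize l.
Proof. by elim: l => // y l IH; rewrite dsize_cons /=; lia. Qed.

Lemma dsize_mem_cat A `{encodable A} (l1 l2 : seq A) y : dsize y <= dsize (l1 ++ y :: l2).
Proof. by elim: l1 => [|z l1 IH] /=; rewrite dsize_cons; lia. Qed.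

(** * Left folds as loops *)

Definition foldl_time A B C (F : A -> B -> C -> B) (tF : A * B * C -> nat) (x : A) :=
  fix T (a : B) (l : seq C) : nat :=
    if l is y :: l' then ((tF (x, a, y)).+1 + 1 + T (F x a y) l').+1 else 1.

Lemma foldl_time_le A B C (F : A -> B -> C -> B) tF (x : A) l a M :
  (forall l1 y l2, l = l1 ++ y :: l2 -> tF (x, foldl (F x) a l1, y) <= M) ->
  foldl_time F tF x a l <= size l * (M + 3) + 1.
Proof.
elim: l a => [//|y l IH] a Hl /=.
have := Hl [::] y l erefl; rewrite /= => h.
have := IH (F x a y) (fun l1 z l2 e => Hl (y :: l1) z l2 (congr1 (cons y) e)).
by rewrite mulSn; lia.
Qed.

(** Variable 0 holds the parameter, 1 the rest of the list, 2 the accumulator. *)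
Definition foldl_loop (p : prog) : prog :=
  While (EVar 1) (Seq (Call 2 p (ENode (ENode (EVar 0) (EVar 2)) (EHd (EVar 1))))
                      (Assign 1 (ETl (EVar 1)))).

Lemma ev_foldl_loop A B C `{encodable A} `{encodable B} `{encodable C}
    (F : A -> B -> C -> B) p tF :
  (forall w : A * B * C, computes p (enc w) (enc (F w.1.1 w.1.2 w.2)) (tF w)) ->
  forall x l a s, s 0 = enc x -> s 1 = enc l -> s 2 = enc a ->
  exists2 s', ev s (foldl_loop p) s' (foldl_time F tF x a l) &
    s' 2 = enc (foldl (F x) a l).
Proof.
move=> hp x; elim=> [|y l IH] a s s0 s1 s2.
  by exists s => //; apply: ev_while_stop; rewrite /= s1.
pose (s3 := upd (upd s 2 (enc (F x a y))) 1 (enc l)).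
have s31 : s3 1 = enc l by [].
have s32 : s3 2 = enc (F x a y) by [].
have [s' E s'2] := IH (F x a y) s3 s0 s31 s32.
exists s' => //; apply: ev_while_step E; first by rewrite /= s1.
apply: (ev_seq (s1 := upd s 2 (enc (F x a y)))).
  by apply: ev_call; rewrite /= s0 s1 s2; apply: (hp (x, a, y)).
have -> : s3 = upd (upd s 2 (enc (F x a y))) 1
                 (eval (upd s 2 (enc (F x a y))) (ETl (EVar 1))).
  by rewrite /s3 /= [X in tl X]/upd /= s1.
exact: ev_assign.
Qed.

(** A polynomial time step could square the size of the accumulator in every round, so all
    intermediate accumulators must be bounded in terms of [x] alone; [take] ranges over the prefixes
    that produce them. *)
Lemma ptime_foldl A B C `{encodable A} `{encodable B} `{encodable C}
    (F : A -> B -> C -> B) (z : A -> B) (l : A -> seq C) :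
  ptime (fun w : A * B * C => F w.1.1 w.1.2 w.2) -> ptime z -> ptime l ->
  pbounded (fun w : A * nat => dsize w.1)
    (fun w => dsize (foldl (F w.1) (z w.1) (take w.2 (l w.1)))) ->
  ptime (fun x => foldl (F x) (z x) (l x)).
Proof.
move=> [p [tp [p1 [cp p2] _]]] [q [tq [q1 q2 _]]] [r [tr [r1 r2 r3]]] [ca ha].
have hb k x : dsize (foldl (F x) (z x) (take k (l x))) <= (dsize x).+2 ^ ca.
  exact: ha (x, k).
exists (Seq (Call 2 q (EVar 0)) (Seq (Call 1 r (EVar 0))
  (Seq (foldl_loop p) (Assign 0 (EVar 2))))).
exists (fun x => (tq x).+1 + ((tr x).+1 + (foldl_time F tp x (z x) (l x) + 1))).
have hid : pbounded (fun x : A => dsize x) (fun x => (dsize x).+2 ^ ca) by exists ca.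
split.
- move=> x; pose (s0 := upd (upd (init (enc x)) 2 (enc (z x))) 1 (enc (l x))).
  have [s E sE] := ev_foldl_loop p1 (erefl : s0 0 = enc x)
    (erefl : s0 1 = enc (l x)) (erefl : s0 2 = enc (z x)).
  exists (upd s 0 (enc (foldl (F x) (z x) (l x)))) => //.
  apply: ev_seq; first (apply: ev_call; exact: q1).
  apply: ev_seq; first (apply: ev_call; exact: r1).
  by apply: ev_seq E _; rewrite -sE; apply: ev_assign.
- apply: pbounded_add; first exact: pbounded_S.
  apply: pbounded_add; first exact: pbounded_S.
  apply: pbounded_add; last exact: pbounded_const.
  (* [M x] bounds the size of every triple passed to the step: parameter, accumulator, and a list
     element, the latter bounded by the whole list. *)
  pose (M := fun x => ((dsize x + (dsize x).+2 ^ ca).+1 + dsize (l x)).+1).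
  have hM : pbounded dsize M.
    apply: pbounded_S; apply: pbounded_add r3; apply: pbounded_S.
    by apply: pbounded_add => //; apply: pbounded_id.
  have hT : pbounded dsize (fun x => (M x).+2 ^ cp).
    by apply: (pbounded_comp hM); exists cp.
  apply: (@pbounded_le _ _ _ (fun x => dsize (l x) * ((M x).+2 ^ cp + 3) + 1)).
    apply: pbounded_add (pbounded_const _ _).
    by apply: pbounded_mul => //; apply: pbounded_add (pbounded_const _ _).
  move=> x; apply: leq_trans (foldl_time_le (M := (M x).+2 ^ cp) _) _.
    move=> l1 y l2 E; apply: leq_trans (p2 _) _.
    case: cp {p2 hT} => [//|cp]; rewrite leq_exp2r //.
    have := hb (size l1) x; rewrite E take_size_cat // => h.
    have h' : dsize y <= dsize (l x) by rewrite E dsize_mem_cat.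
    by rewrite !dsize_pair /M; lia.
  by rewrite leq_add2r leq_mul2r size_dsize orbT.
- apply: (pbounded_le hid) => x.
  by have := hb (size (l x)) x; rewrite take_size.
Qed.

Lemma foldl_size_le B C `{encodable B}
    (F : B -> C -> B) (z : B) (l : seq C) h :
  (forall a l1 y l2, l = l1 ++ y :: l2 -> dsize (F a y) <= dsize a + h) ->
  dsize (foldl F z l) <= dsize z + size l * h.
Proof.
elim: l z => [|y l IH] z hF /=; first by rewrite addn0.
have h1 := hF z [::] y l erefl.
have := IH (F z y) (fun a l1 u l2 e => hF a (y :: l1) u l2 (congr1 (cons y) e)).
by rewrite mulSn; lia.
Qed.

(** Growth by at most [h x] per step adds up to a polynomial. The equation for [l x] expresses
    membership of [y] without requiring decidable equality. *)
Lemma ptime_foldl_add A B C `{encodable A} `{encodable B} `{encodable C}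
    (F : A -> B -> C -> B) (z : A -> B) (l : A -> seq C) (h : A -> nat) :
  ptime (fun w : A * B * C => F w.1.1 w.1.2 w.2) -> ptime z -> ptime l ->
  pbounded dsize h ->
  (forall x a l1 y l2, l x = l1 ++ y :: l2 -> dsize (F x a y) <= dsize a + h x) ->
  ptime (fun x => foldl (F x) (z x) (l x)).
Proof.
move=> pF pz pl ph hF; apply: ptime_foldl => //.
have [_ [_ [_ _ bz]]] := pz; have [_ [_ [_ _ bl]]] := pl.
have [c hc] := pbounded_add bz (pbounded_mul bl ph).
exists c => -[x k] /=; apply: leq_trans (hc x).
have hf : dsize (foldl (F x) (z x) (take k (l x)))
    <= dsize (z x) + size (take k (l x)) * h x.
  apply: foldl_size_le => a l1 y l2 E; apply: (hF _ _ l1 y (l2 ++ drop k (l x))).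
  by rewrite -{1}(cat_take_drop k (l x)) E -catA.
apply: leq_trans hf _; rewrite leq_add2l leq_mul2r (leq_trans _ (size_dsize _)) ?orbT //.
by rewrite size_take; case: ltnP => // /ltnW.
Qed.

(** One test of the encoding separates the empty list, or zero, from the other case; this
    accommodates functions with a default value. *)
Lemma ptime_prim A B `{encodable A} `{encodable B} e e1 e2 (f : A -> B) :
  (forall x, enc (f x) = eval (init (enc x))
                         (if nonleaf (eval (init (enc x)) e) then e1 else e2)) ->
  pbounded dsize (fun x => dsize (f x)) -> ptime f.
Proof.
move=> E hs; exists (If e (Assign 0 e1) (Assign 0 e2)), (fun=> 2); split=> //.
  move=> x; exists (upd (init (enc x)) 0 (enc (f x))) => //.
  by rewrite E; apply: ev_if; case: nonleaf; apply: ev_assign.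
exact: pbounded_const.
Qed.

(** * Basic functions on lists and numbers *)

Section Primitives.
Context {B : Type} `{eB : encodable B}.

Lemma ptime_nilp : ptime (fun l : seq B => nilp l).
Proof.
apply: (@ptime_prim _ _ _ _ (EVar 0) ELeaf (expr_of (enc true))) => [[]//|].
by apply: (pbounded_le (pbounded_const _ 3)) => l; apply: dsize_bool.
Qed.

Lemma ptime_head (x0 : B) : ptime (fun l : seq B => head x0 l).
Proof.
apply: (@ptime_prim _ _ _ _ (EVar 0) (EHd (EVar 0)) (expr_of (enc x0))).
  by case=> //=; rewrite eval_expr_of.
apply: (pbounded_le (pbounded_add (pbounded_const _ (dsize x0)) (pbounded_id _))) => -[|y l].
  by rewrite leq_addr.
by rewrite dsize_cons /=; lia.
Qed.

Lemma ptime_behead : ptime (fun l : seq B => behead l).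
Proof.
apply: (@ptime_expr _ _ _ _ (ETl (EVar 0))) => [[]//|].
by apply: (pbounded_le (pbounded_id _)) => -[|y l] //; rewrite dsize_cons /=; lia.
Qed.

Lemma ptime_cons : ptime (fun w : B * seq B => w.1 :: w.2).
Proof.
by apply: (@ptime_expr _ _ _ _ (EVar 0)) => //; apply: pbounded_id.
Qed.

Lemma ptime_Some : ptime (fun x : B => Some x).
Proof.
apply: (@ptime_expr _ _ _ _ (ENode ELeaf (EVar 0))) => //.
by apply: (pbounded_le (pbounded_add (pbounded_const _ 2) (pbounded_id _))) => x.
Qed.

(** Retyping a value as a tree leaves its encoding unchanged; it allows heterogeneous data in one
    list. *)
Lemma ptime_enc : ptime (fun x : B => enc x).
Proof. by apply: (@ptime_expr _ _ _ _ (EVar 0)) => //; apply: pbounded_id. Qed.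

Lemma ptime_S : ptime S.
Proof.
apply: (@ptime_expr _ _ _ _ (ENode ELeaf (EVar 0))) => //.
by apply: (pbounded_le (pbounded_add (pbounded_const _ 2) (pbounded_id _))) => x.
Qed.

Lemma ptime_pred : ptime predn.
Proof.
apply: (@ptime_expr _ _ _ _ (ETl (EVar 0))) => [[]//|].
by apply: (pbounded_le (pbounded_id _)) => x; rewrite !dsize_nat; lia.
Qed.

Lemma ptime_eq0 : ptime (fun n => n == 0).
Proof.
apply: (@ptime_prim _ _ _ _ (EVar 0) ELeaf (expr_of (enc true))) => [[]//|].
by apply: (pbounded_le (pbounded_const _ 3)) => l; apply: dsize_bool.
Qed.

(* The unary encoding of a number is that of a list of leaves. *)
Lemma ptime_nseq : ptime (fun n => nseq n Leaf).
Proof.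
have E n : @enc (seq tree) _ (nseq n Leaf) = enc_nat n by elim: n => //= n <-.
apply: (@ptime_expr _ _ _ _ (EVar 0)) => [n|]; first by rewrite E.
by apply: (pbounded_le (pbounded_id _)) => n; rewrite /dsize E.
Qed.

Lemma ptime_size : ptime (fun l : seq B => size l).
Proof.
have E (l : seq B) : size l = foldl (fun n _ => n.+1) 0 l.
  by elim/last_ind: l => // l x IH; rewrite foldl_rcons size_rcons IH.
apply: ptime_ext (fsym E) _; apply: (ptime_foldl_add (h := fun=> 2)).
- exact: ptime_comp ptime_S (ptime_comp ptime_snd ptime_fst).
- exact: ptime_const.
- exact: ptime_id.
- exact: pbounded_const.
- by move=> *; rewrite !dsize_nat; lia.
Qed.

End Primitives.

Lemma ptime_negb A `{encodable A} (b : A -> bool) :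
  ptime b -> ptime (fun x => ~~ b x).
Proof. by move=> pb; apply: (ptime_if pb); apply: ptime_const. Qed.

Lemma ptime_andb A `{encodable A} (b c : A -> bool) :
  ptime b -> ptime c -> ptime (fun x => b x && c x).
Proof. by move=> pb pc; apply: (ptime_if pb pc); apply: ptime_const. Qed.

Lemma ptime_orb A `{encodable A} (b c : A -> bool) :
  ptime b -> ptime c -> ptime (fun x => b x || c x).
Proof. by move=> pb pc; apply: (ptime_if pb _ pc); apply: ptime_const. Qed.

(* Extended below, by redefinition, as more functions become available. *)
Ltac ptime_user := fail.

Ltac ptime_step := cbv beta;
  lazymatch goal with
  | |- ptime (fun _ => ?b) => exact: ptime_const
  | |- ptime (fun w => w) => exact: ptime_id
  | |- ptime fst => exact: ptime_fst
  | |- ptime snd => exact: ptime_snd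
  | |- ptime (fun w => fst _) => apply: (ptime_comp ptime_fst)
  | |- ptime (fun w => snd _) => apply: (ptime_comp ptime_snd)
  | |- ptime (fun w => (_, _)) => apply: ptime_pair
  | |- ptime (fun w => if _ then _ else _) => apply: ptime_if
  | |- ptime (fun w => negb _) => apply: ptime_negb
  | |- ptime (fun w => andb _ _) => apply: ptime_andb
  | |- ptime (fun w => orb _ _) => apply: ptime_orb
  | |- ptime (fun w => _ :: _) => apply: (ptime_comp2 ptime_cons)
  | |- ptime (fun w => nilp _) => apply: (ptime_comp ptime_nilp)
  | |- ptime (fun w => behead _) => apply: (ptime_comp ptime_behead)
  | |- ptime (fun w => head _ _) => apply: (ptime_comp (ptime_head _))
  | |- ptime (fun w => Some _) => apply: (ptime_comp ptime_Some)
  | |- ptime (fun w => enc _) => apply: (ptime_comp ptime_enc)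
  | |- ptime (fun w => S _) => apply: (ptime_comp ptime_S)
  | |- ptime (fun w => predn _) => apply: (ptime_comp ptime_pred)
  | |- ptime (fun w => nseq _ Leaf) => apply: (ptime_comp ptime_nseq)
  | |- ptime (fun w => size _) => apply: (ptime_comp ptime_size)
  | H : ptime ?f |- ptime ?f => exact: H
  | H : ptime ?f |- ptime (fun w => ?f _) => apply: (ptime_comp H)
  | H : ptime (fun w => ?f w.1 w.2) |- ptime (fun w => ?f _ _) => apply: (ptime_comp2 H)
  | |- _ => ptime_user
  end.

Ltac ptime_auto := repeat ptime_step.

Lemma ptime_sub : ptime (fun w : nat * nat => w.1 - w.2).
Proof.
have E (w : nat * nat) : foldl (fun n _ => n.-1) w.1 (nseq w.2 Leaf) = w.1 - w.2.
  case: w => a b /=; elim: b a => [|b IH] a /=; first by rewrite subn0.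
  by rewrite IH; lia.
apply: ptime_ext E _; apply: (ptime_foldl_add (h := fun=> 0)); try by ptime_auto.
  exact: pbounded_const.
by move=> *; rewrite !dsize_nat; lia.
Qed.

Lemma ptime_leq : ptime (fun w : nat * nat => w.1 <= w.2).
Proof. exact: ptime_comp ptime_eq0 ptime_sub. Qed.

Lemma ptime_eqn : ptime (fun w : nat * nat => w.1 == w.2).
Proof.
apply: (ptime_ext (f := fun w : nat * nat => (w.1 <= w.2) && (w.2 <= w.1))).
  by move=> w; rewrite eqn_leq.
by apply: ptime_andb; apply: (ptime_comp2 ptime_leq); ptime_auto.
Qed.

Lemma ptime_eq_pair (T U : eqType) `{encodable T} `{encodable U} :
  ptime (fun w : T * T => w.1 == w.2) -> ptime (fun w : U * U => w.1 == w.2) ->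
  ptime (fun w : (T * U) * (T * U) => w.1 == w.2).
Proof.
move=> pT pU.
apply: (ptime_ext (f := fun w : (T * U) * (T * U) =>
    (w.1.1 == w.2.1) && (w.1.2 == w.2.2))); first by case=> [[a b] [c d]].
apply: ptime_andb; [apply: (ptime_comp2 pT) | apply: (ptime_comp2 pU)]; ptime_auto.
Qed.

Lemma ptime_foldl_bool A C `{encodable A} `{encodable C}
    (F : A -> bool -> C -> bool) (z : A -> bool) (l : A -> seq C) :
  ptime (fun w : A * bool * C => F w.1.1 w.1.2 w.2) -> ptime z -> ptime l ->
  ptime (fun x => foldl (F x) (z x) (l x)).
Proof.
move=> pF pz pl; apply: ptime_foldl => //.
by apply: (pbounded_le (pbounded_const _ 3)) => w; apply: dsize_bool.
Qed.

Lemma ptime_has A C `{encodable A} `{encodable C} (P : A -> C -> bool) (l : A -> seq C) :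
  ptime (fun w : A * C => P w.1 w.2) -> ptime l -> ptime (fun x => has (P x) (l x)).
Proof.
move=> pP pl.
have E x : foldl (fun b y => b || P x y) false (l x) = has (P x) (l x).
  elim/last_ind: (l x) => // s y IH.
  by rewrite foldl_rcons IH has_rcons orbC.
apply: ptime_ext E _; apply: ptime_foldl_bool => //; last by ptime_auto.
by ptime_auto.
Qed.

Lemma ptime_all A C `{encodable A} `{encodable C} (P : A -> C -> bool) (l : A -> seq C) :
  ptime (fun w : A * C => P w.1 w.2) -> ptime l -> ptime (fun x => all (P x) (l x)).
Proof.
move=> pP pl.
have E x : ~~ has (fun y => ~~ P x y) (l x) = all (P x) (l x).
  by rewrite has_predC negbK.
by apply: ptime_ext E _; apply: ptime_negb; apply: ptime_has => //; apply: ptime_negb.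
Qed.

Lemma ptime_mem A (T : eqType) `{encodable A} `{encodable T}
    (f : A -> T) (l : A -> seq T) :
  ptime (fun w : T * T => w.1 == w.2) -> ptime f -> ptime l ->
  ptime (fun x => f x \in l x).
Proof.
move=> pT pf pl; have E x : has (fun y => y == f x) (l x) = (f x \in l x).
  exact: has_pred1.
apply: ptime_ext E _; apply: ptime_has => //.
by apply: (ptime_comp2 pT); ptime_auto.
Qed.

Lemma ptime_catrev A C `{encodable A} `{encodable C} (l r : A -> seq C) :
  ptime l -> ptime r -> ptime (fun x => catrev (l x) (r x)).
Proof.
move=> pl pr.
have E x : foldl (fun a y => y :: a) (r x) (l x) = catrev (l x) (r x).
  by elim: (l x) (r x) => //= y s IH a; rewrite IH.
apply: ptime_ext E _.
have [_ [_ [_ _ bl]]] := pl.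
apply: (ptime_foldl_add (h := fun x => (dsize (l x)).+1)) => //; try by ptime_auto.
  exact: pbounded_S.
move=> x a l1 y l2 E; rewrite dsize_cons.
have : dsize y <= dsize (l x) by rewrite E dsize_mem_cat.
by lia.
Qed.

Lemma ptime_rev A C `{encodable A} `{encodable C} (l : A -> seq C) :
  ptime l -> ptime (fun x => rev (l x)).
Proof. by move=> pl; apply: ptime_catrev => //; apply: ptime_const. Qed.

Lemma ptime_cat A C `{encodable A} `{encodable C} (l r : A -> seq C) :
  ptime l -> ptime r -> ptime (fun x => l x ++ r x).
Proof.
move=> pl pr; have E x : catrev (rev (l x)) (r x) = l x ++ r x by rewrite catrevE revK.
by apply: ptime_ext E _; apply: ptime_catrev => //; apply: ptime_rev.
Qed.

Lemma ptime_filter A C `{encodable A} `{encodable C} (P : A -> C -> bool) (l : A -> seq C) :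
  ptime (fun w : A * C => P w.1 w.2) -> ptime l -> ptime (fun x => filter (P x) (l x)).
Proof.
move=> pP pl.
have E x : rev (foldl (fun a y => if P x y then y :: a else a) [::] (l x)) = filter (P x) (l x).
  elim/last_ind: (l x) => // s y IH.
  by rewrite foldl_rcons filter_rcons; case: ifP => _; rewrite ?rev_cons IH.
apply: ptime_ext E _; apply: ptime_rev.
have [_ [_ [_ _ bl]]] := pl.
apply: (ptime_foldl_add (h := fun x => (dsize (l x)).+1)) => //; try by ptime_auto.
- exact: pbounded_S.
move=> x a l1 y l2 E; have : dsize y <= dsize (l x) by rewrite E dsize_mem_cat.
by case: ifP => _; rewrite ?dsize_cons; lia.
Qed.

Lemma ptime_map A C D `{encodable A} `{encodable C} `{encodable D}
    (G : A -> C -> D) (l : A -> seq C) :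
  ptime (fun w : A * C => G w.1 w.2) -> ptime l -> ptime (fun x => map (G x) (l x)).
Proof.
move=> pG pl.
have E x : rev (foldl (fun a y => G x y :: a) [::] (l x)) = map (G x) (l x).
  elim/last_ind: (l x) => // s y IH.
  by rewrite foldl_rcons map_rcons rev_cons IH.
apply: ptime_ext E _; apply: ptime_rev.
have [_ [_ [_ _ bl]]] := pl; have [_ [_ [_ _ [c hc]]]] := pG.
apply: (ptime_foldl_add (h := fun x => ((dsize x + dsize (l x)).+1.+2 ^ c).+1)) => //.
- by ptime_auto.
- by ptime_auto.
- apply: pbounded_S; apply: pbounded_comp (pbounded_S (pbounded_add (pbounded_id _) bl)) _.
  by exists c.
move=> x a l1 y l2 E; have h : dsize y <= dsize (l x) by rewrite E dsize_mem_cat.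
have h2 : dsize (G x y) <= (dsize x + dsize y).+1.+2 ^ c by exact: hc (x, y).
rewrite dsize_cons addnS ltnS addnC leq_add2l (leq_trans h2) //.
by case: (c) => // c'; rewrite leq_exp2r //; lia.
Qed.

Lemma ptime_flatten A C `{encodable A} `{encodable C} (l : A -> seq (seq C)) :
  ptime l -> ptime (fun x => flatten (l x)).
Proof.
move=> pl.
have E x : foldl (fun a y => a ++ y) [::] (l x) = flatten (l x).
  by elim/last_ind: (l x) => // s y IH; rewrite foldl_rcons flatten_rcons IH.
apply: ptime_ext E _; have [_ [_ [_ _ bl]]] := pl.
apply: (ptime_foldl_add (h := fun x => dsize (l x))) => //; try by ptime_auto.
  by apply: ptime_cat; ptime_auto.
move=> x a l1 y l2 E; have h : dsize y <= dsize (l x) by rewrite E dsize_mem_cat.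
have h2 : dsize (a ++ y) <= dsize a + dsize y; last by lia.
by elim: a => [|u a IH]; rewrite ?leq_addl // cat_cons !dsize_cons; lia.
Qed.

Lemma foldl_nseq B (g : B -> B) z n :
  foldl (fun a (_ : tree) => g a) z (nseq n Leaf) = iter n g z.
Proof. by elim: n z => // n IH z; rewrite iterSr -IH. Qed.

(** Iteration is a fold over a list of leaves; [minn] ranges over the rounds up to [n x], all of
    which need a common size bound. *)
Lemma ptime_iter A B `{encodable A} `{encodable B}
    (G : A -> B -> B) (z : A -> B) (n : A -> nat) :
  ptime (fun w : A * B => G w.1 w.2) -> ptime z -> ptime n ->
  pbounded (fun w : A * nat => dsize w.1)
    (fun w => dsize (iter (minn w.2 (n w.1)) (G w.1) (z w.1))) ->
  ptime (fun x => iter (n x) (G x) (z x)).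
Proof.
move=> pG pz pn b.
apply: (ptime_ext (fun x => foldl_nseq (G x) (z x) (n x))).
apply: (ptime_foldl (F := fun x a (_ : tree) => G x a)) => //.
- by apply: (ptime_comp2 pG); ptime_auto.
- exact: ptime_comp ptime_nseq pn.
apply: (pbounded_le b) => -[x k] /=.
suff -> : take k (nseq (n x) Leaf) = nseq (minn k (n x)) Leaf by rewrite foldl_nseq.
by elim: k (n x) => [|k IH] [|m] //=; rewrite IH minnSS.
Qed.

(** The length of the list built so far serves as the counter, so the range comes out reversed. *)
Definition iota_step (s : seq nat) := size s :: s.

Lemma size_iota_step n : size (iter n iota_step [::]) = n.
Proof. by elim: n => //= n ->. Qed.

Lemma rev_iota_step n : rev (iter n iota_step [::]) = iota 0 n.
Proof.
elim: n => // n IH.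
by rewrite iterS rev_cons size_iota_step IH -addn1 iotaD cats1.
Qed.

Lemma ptime_iota : ptime (fun n => iota 0 n).
Proof.
apply: (ptime_ext rev_iota_step); apply: ptime_rev.
apply: (ptime_iter (G := fun _ => iota_step)).
- by rewrite /iota_step; ptime_auto.
- by ptime_auto.
- by ptime_auto.
apply: (@pbounded_le _ _ _ (fun w : nat * nat => dsize w.1 * (dsize w.1).+1 + 1)).
  apply: pbounded_add (pbounded_const _ _); apply: pbounded_mul (pbounded_id _) _.
  exact: pbounded_S (pbounded_id _).
move=> [n k] /=; have : minn k n <= n by apply: geq_minr.
move: (minn k n) => i; rewrite dsize_nat => lei.
have : dsize (iter i iota_step [::]) <= i * (2 * n + 2) + 1; last by nia.
elim: i lei => [|i IH] lei //; have h := IH (ltnW lei).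
rewrite iterS; move: (size_iota_step i) h; move: (iter _ _ _) => s hs h.
by rewrite dsize_cons hs dsize_nat; lia.
Qed.

Lemma ptime_nth A C `{encodable A} `{encodable C} (x0 : C) (l : A -> seq C) (n : A -> nat) :
  ptime l -> ptime n -> ptime (fun x => nth x0 (l x) (n x)).
Proof.
move=> pl pn; have E x : head x0 (iter (n x) behead (l x)) = nth x0 (l x) (n x).
  by elim: (n x) (l x) => [|k IH] [|y s] //; rewrite iterSr IH /= ?nth_nil.
apply: (ptime_ext E); apply: (ptime_comp (ptime_head x0)).
apply: (ptime_iter (G := fun _ s => behead s)) => //; first by ptime_auto.
have [_ [_ [_ _ bl]]] := pl; case: bl => c hc; exists c => -[x k] /=.
apply: leq_trans (hc x); elim: (minn _ _) => // i IH.
apply: leq_trans IH; rewrite iterS.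
by case: (iter _ _ _) => // y s; rewrite dsize_cons /=; lia.
Qed.

Lemma dsize_filter C `{encodable C} (P : pred C) (l : seq C) :
  dsize (filter P l) <= dsize l.
Proof.
by elim: l => [|y l IH] //=; case: (P y) => /=; rewrite ?dsize_cons; lia.
Qed.

Ltac ptime_eq := first
  [ exact: ptime_eqn | apply: ptime_eq_pair; ptime_eq | eassumption ].

Ltac ptime_user ::=
  lazymatch goal with
  | |- ptime (fun w => subn _ _) => apply: (ptime_comp2 ptime_sub)
  | |- ptime (fun w => leq _ _) => apply: (ptime_comp2 ptime_leq)
  | |- ptime (fun w => nth _ _ _) => apply: ptime_nth
  | |- ptime (iota 0) => exact: ptime_iota
  | |- ptime (fun w => iota 0 _) => apply: (ptime_comp ptime_iota)
  | |- ptime (fun w => has _ _) => apply: ptime_has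
  | |- ptime (fun w => all _ _) => apply: ptime_all
  | |- ptime (fun w => map _ _) => apply: ptime_map
  | |- ptime (fun w => filter _ _) => apply: ptime_filter
  | |- ptime (fun w => flatten _) => apply: ptime_flatten
  | |- ptime (fun w => cat _ _) => apply: ptime_cat
  | |- ptime (fun w => rev _) => apply: ptime_rev
  | |- ptime (fun w => in_mem _ (mem _)) => apply: ptime_mem; [ptime_eq | |]
  | |- ptime (fun w => @eq_op _ _ _) => apply: ptime_comp2; [ptime_eq | |]
  end.

(** * Reachability *)

Definition edge_rel (T : eqType) (E : seq (T * T)) : rel T := fun a b => (a, b) \in E.

(** Filtering [V], instead of appending successors to [R], keeps every iterate no larger than
    [V]. *)
Definition reach_step (T : eqType) (V : seq T) (E : seq (T * T)) (R : seq T) : seq T :=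
  [seq y <- V | (y \in R) || has (fun x => (x, y) \in E) R].

Definition reach (T : eqType) (V : seq T) (E : seq (T * T)) (s : T) : seq T :=
  iter (size V) (reach_step V E) [:: s].

(** A path can be shortened to one without repeated vertices, all of which lie in [V]; hence
    [size V] rounds reach everything. *)
Lemma mem_reach (T : eqType) (V : seq T) (E : seq (T * T)) s y :
  s \in V -> (forall a b, (a, b) \in E -> b \in V) ->
  reflect (exists2 p, path (edge_rel E) s p & last s p = y) (y \in reach V E s).
Proof.
move=> sV EV; apply: (iffP idP).
  rewrite /reach; elim: (size V) y => [|k IH] y.
    by rewrite inE => /eqP ->; exists [::].
  rewrite iterS mem_filter => /andP[/orP[/IH //|/hasP[x /IH[p px lx] xy]] _].
  by exists (rcons p y); rewrite ?last_rcons // rcons_path px lx.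
case=> p /shortenP[p' pp' up' _] {p} <-.
have subV : {subset s :: p' <= V}.
  move=> z; rewrite inE => /predU1P[-> //|].
  elim: p' (s) pp' {up'} => //= a p IH u /andP[ua pa].
  by rewrite inE => /predU1P[-> |/(IH a pa) //]; apply: EV ua.
have: size p' <= size V by apply: ltnW; apply: uniq_leq_size up' subV.
rewrite /reach; move: (size V) => N.
elim/last_ind: p' N pp' {up'} subV => [|p z IH] N.
  move=> _ _ _; elim: N => [|N IH]; first by rewrite inE.
  by rewrite iterS mem_filter IH sV.
rewrite rcons_path size_rcons last_rcons => /andP[pp lz] subV.
case: N => // N szN; rewrite iterS mem_filter.
rewrite subV ?inE ?mem_rcons ?mem_head ?orbT // andbT; apply/orP; right.
apply/hasP; exists (last s p) => //; apply: IH => // u us; apply: subV.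
by move: us; rewrite !inE mem_rcons inE => /orP[-> //|->]; rewrite !orbT.
Qed.

Lemma ptime_reach A (T : eqType) `{encodable A} `{encodable T}
    (V : A -> seq T) (E : A -> seq (T * T)) (s : A -> T) :
  ptime (fun w : T * T => w.1 == w.2) -> ptime V -> ptime E -> ptime s ->
  ptime (fun x => reach (V x) (E x) (s x)).
Proof.
move=> pT pV pE ps.
apply: (ptime_iter (G := fun x => reach_step (V x) (E x))).
- by rewrite /reach_step; ptime_auto.
- by ptime_auto.
- by ptime_auto.
have [_ [_ [_ _ bs]]] := ps; have [_ [_ [_ _ bV]]] := pV.
have [c hc] := pbounded_add (pbounded_add bs (pbounded_const _ 2)) bV.
exists c => -[x k] /=; apply: leq_trans (hc x).
have h1 : dsize [:: s x] = dsize (s x) + 2 by rewrite dsize_cons addn1 addn2.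
rewrite -h1; case: (minn _ _) => [|i]; first exact: leq_addr.
by rewrite iterS (leq_trans (dsize_filter _ _)) ?leq_addl.
Qed.

(** * The query loop *)

Section History.
Variables (S : csp_at) (m : nat).

Definition entry : Type := (assignment S * ('I_m * (arity S).-tuple 'I_(len S)))%type.

Definition entry_key (e : entry) : 'I_m * (arity S).-tuple 'I_(alph S) :=
  (e.2.1, [tuple of [seq tnth e.1 i | i <- e.2.2]]).

Definition valid_entry (I : m.-tuple (constraint S)) (e : entry) : Prop :=
  [/\ adm e.1, ~~ satisfies e.1 (tnth I e.2.1) & e.2.2 = (tnth I e.2.1).2].

Fixpoint valid_history (I : m.-tuple (constraint S)) (h : seq entry) : Prop :=
  if h is e :: h' then valid_entry I e /\ valid_history I h' else True.

Fixpoint compatible (h : seq entry) (a : assignment S) : Prop :=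
  if h is e :: h' then
    [tuple of [seq tnth a i | i <- e.2.2]] <> (entry_key e).2 /\ compatible h' a
  else True.

(** Deliberately asymmetric: a candidate only has to respect the exclusions, whereas a refusal is a
    claim about the hidden instance. *)
Definition good (I : m.-tuple (constraint S)) (h : seq entry)
    (o : option (assignment S)) : Prop :=
  if o is Some a then adm a /\ compatible h a else forall a, ~ solution I a.

Definition params (n : nat) : seq nat := [:: n; m; alph S; len S; arity S].

Definition tuple_data k w (a : k.-tuple 'I_w) : seq nat := [seq val i | i <- a].

Definition entry_data (e : entry) : seq nat * (nat * seq nat) :=
  (tuple_data e.1, (val e.2.1, tuple_data e.2.2)).

Lemma enc_tuple_data k w (a : k.-tuple 'I_w) : enc (tuple_data a) = enc_tuple a.
Proof. by rewrite /enc_tuple /tuple_data /enc /encodable_seq -map_comp. Qed.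

(** An old entry with the same key would concern the same constraint, hence the same variables, and
    would exclude exactly the restriction of [a] to them. *)
Lemma valid_fresh I h a j : valid_history I h -> compatible h a ->
  entry_key (a, (j, (tnth I j).2)) \notin map entry_key h.
Proof.
elim: h => //= e h IH [[_ _ ev] vh] [ce ch]; rewrite inE negb_or IH // andbT.
apply/negP => /eqP E; apply: ce; have := congr1 snd E => /= <-.
by rewrite ev -[e.2.1](congr1 fst E).
Qed.

Lemma size_uniq_keys h : uniq (map entry_key h) -> size h <= m * alph S ^ arity S.
Proof.
move=> uh; rewrite -(size_map entry_key) -(card_uniqP uh).
by apply: leq_trans (max_card _) _; rewrite card_prod card_tuple !card_ord.
Qed.

End History.

(* Variables: 0 parameters, 1 history, 2 loop flag, 3 candidate, 4 answer. *)
Definition query_step (P : prog) : prog :=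
  Seq (Call 3 P (ENode (EVar 0) (EVar 1)))
    (If (EVar 3)
      (Seq (Query 4 (ETl (EVar 3)))
        (If (EVar 4) (Assign 1 (ENode (ENode (ETl (EVar 3)) (EVar 4)) (EVar 1)))
                     (Assign 2 ELeaf)))
      (Assign 2 ELeaf)).

Definition query_loop (P : prog) : prog :=
  Seq (Assign 2 (ENode ELeaf ELeaf))
    (Seq (While (EVar 2) (query_step P)) (Assign 0 (EVar 3))).

(** Only histories that can arise are considered: validity is what justifies a refusal, and distinct
    keys bound the size of the input of [P]. *)
Definition finds (S : csp) (P : prog) (n m T : nat) (I : m.-tuple (constraint (S n))) :=
  forall h : seq (entry (S n) m), valid_history I h -> uniq (map (@entry_key _ _) h) ->
  exists o t, [/\ computes P (enc (params (S n) m n, map (@entry_data _ _) h))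
                    (enc_output o) t,
                  good I h o & t <= T].

(** Beyond the solver's own time, the 5 steps are the call, the test of the candidate, the query,
    the test of the answer and one assignment. *)
Lemma query_step_exec (S : csp) P n m T I O k h s :
  @finds S P n m T I -> V_oracle I O ->
  valid_history I h -> uniq (map (@entry_key _ _) h) ->
  s 0 = enc (params (S n) m n) -> s 1 = enc (map (@entry_data _ _) h) ->
  s 2 = Node Leaf Leaf ->
  exists k' s' t, [/\ exec (oracle_of O) k s (query_step P) k' s' t, t <= T + 5 &
    (s' 2 = Leaf /\ exists2 o, s' 3 = enc_output o & correct_output I o) \/
    exists e, [/\ valid_history I (e :: h), uniq (map (@entry_key _ _) (e :: h)),
      s' 0 = s 0, s' 1 = enc (map (@entry_data _ _) (e :: h)) & s' 2 = Node Leaf Leaf]].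
Proof.
move=> fP vO vh uh s0 s1 s2; have [o [t [E go tT]]] := fP h vh uh.
have E1 : ev s (Call 3 P (ENode (EVar 0) (EVar 1))) (upd s 3 (enc_output o)) t.+1.
  by apply: ev_call; rewrite /= s0 s1.
case: o go {E} E1 => [a [ada ca]|no] E1; last first.
  exists k, (upd (upd s 3 Leaf) 2 Leaf), (t.+1 + 2); split.
  - apply: exec_seq; first exact: E1.
    by apply: exec_if; apply: ev_assign.
  - by lia.
  by left; split=> //; exists None.
pose s' := upd (upd s 3 (enc_output (Some a))) 4 (enc_answer (O k a)).
have E2 : exec (oracle_of O) k (upd s 3 (enc_output (Some a)))
    (Query 4 (ETl (EVar 3))) k.+1 s' 1.
  by apply: exec_query; exists a.
have nl : nonleaf (eval s' (EVar 4)) = (O k a != None).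
  by rewrite /= /s' /upd /=; case: (O k a) => [[]|].
have := vO k a ada; case Oka: (O k a) => [[j v]|]; rewrite Oka /= in nl; last first.
  move=> sa; exists k.+1, (upd s' 2 Leaf), (t.+1 + (1 + 2).+1); split.
  - apply: exec_seq; first exact: E1.
    apply: exec_if; apply: exec_seq; first exact: E2.
    by apply: exec_if; rewrite nl; apply: ev_assign.
  - by lia.
  by left; split=> //; exists (Some a).
move=> [na ev]; subst v; pose e : entry (S n) m := (a, (j, (tnth I j).2)).
pose (w := enc (map (@entry_data _ _) (e :: h))).
exists k.+1, (upd s' 1 w), (t.+1 + (1 + 2).+1); split.
- apply: exec_seq; first exact: E1.
  apply: exec_if; apply: exec_seq; first exact: E2.
  apply: exec_if; rewrite nl.
  have -> : w = eval s' (ENode (ENode (ETl (EVar 3)) (EVar 4)) (EVar 1)).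
    rewrite /s' /= /upd /= s1 Oka /w /= -!enc_tuple_data.
    by [].
  exact: ev_assign.
- by lia.
right; exists e; split=> //=.
by rewrite uh andbT; apply: valid_fresh.
Qed.

Lemma query_loop_exec (S : csp) P n m T I O : @finds S P n m T I -> V_oracle I O ->
  forall d k h s, valid_history I h -> uniq (map (@entry_key _ _) h) ->
  m * alph (S n) ^ arity (S n) <= size h + d ->
  s 0 = enc (params (S n) m n) -> s 1 = enc (map (@entry_data _ _) h) ->
  s 2 = Node Leaf Leaf ->
  exists k' s' t o, [/\ exec (oracle_of O) k s (While (EVar 2) (query_step P)) k' s' t,
    s' 3 = enc_output o, correct_output I o & t <= d.+1 * (T + 6) + 1].
Proof.
move=> fP vO; elim=> [|d IH] k h s vh uh hd s0 s1 s2.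
all: have nl : nonleaf (eval s (EVar 2)) by rewrite /= s2.
all: have [k1 [s' [t [E tT []]]]] := query_step_exec k fP vO vh uh s0 s1 s2.
- move=> [s'2 [o s'3 co]]; exists k1, s', (t + 1).+1, o; split=> //; last by lia.
  by apply: exec_while_step E _ => //; apply: ev_while_stop; rewrite /= s'2.
- by move=> [e [_ /size_uniq_keys/leq_trans/(_ hd)]]; rewrite addn0 ltnn.
- move=> [s'2 [o s'3 co]]; exists k1, s', (t + 1).+1, o; split=> //; last by lia.
  by apply: exec_while_step E _ => //; apply: ev_while_stop; rewrite /= s'2.
move=> [e [ve ue s'0 s'1 s'2]].
have [||k2 [s'' [t2 [o [E' s3 co t2T]]]]] := IH k1 _ _ ve ue _ _ s'1 s'2.
- by rewrite /= addSnnS.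
- by rewrite s'0.
exists k2, s'', (t + t2).+1, o; split=> //; last by rewrite mulSn; lia.
exact: exec_while_step E E'.
Qed.

(** Gives the shape of bound asked for by [hidden_poly_solvable]: [N + 2] is at most [3 * N] for
    positive [N], and the added constant covers [N = 0]. *)
Lemma leq_pow_affine N c : N.+2 ^ c <= 3 ^ c * N ^ c + 3 ^ c.
Proof.
case: c => [//|c]; case: N => [|N].
  by rewrite (leq_trans _ (leq_addl _ _)) // leq_exp2r.
by rewrite -expnMn (leq_trans _ (leq_addr _ _)) // leq_exp2r //; lia.
Qed.

Lemma hidden_poly_solvableI (S : csp) (P : prog) (b : nat) (T : nat * nat -> nat) :
  (forall n, alph (S n) ^ arity (S n) <= b) ->
  pbounded (fun x : nat * nat => x.1 + x.2) T ->
  (forall n m (I : m.-tuple (constraint (S n))), is_instance I -> finds P (T (n, m)) I) ->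
  hidden_poly_solvable S.
Proof.
move=> Sb bT fP.
(* At most [(n + m) * b + 1] rounds of [T + 6] steps, plus 3 for the two outer assignments and the
   last loop test. *)
have [c hc] : pbounded (fun x : nat * nat => x.1 + x.2)
    (fun x => (x.1 + x.2) * b * (T x + 6) + (T x + 6) + 3).
  apply: pbounded_add (pbounded_const _ _); apply: pbounded_add.
    apply: pbounded_mul; first by apply: pbounded_mul (pbounded_id _) (pbounded_const _ _).
    by apply: pbounded_add => //; apply: pbounded_const.
  by apply: pbounded_add => //; apply: pbounded_const.
exists (query_loop P), (3 ^ c), c => n m I inst O vO.
have fI := fP n m I inst.
pose s := upd (init (enc_seq (enc_params (S n) n m))) 2 (Node Leaf Leaf).
have [||||||k [s' [t [o [E s3 co tT]]]]] :=
    query_loop_exec fI vO (d := m * alph (S n) ^ arity (S n)) 0 (h := [::]) (s := s).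
all: rewrite //=.
exists o, (1 + (t + 1)); split=> //.
  exists k, (upd s' 0 (enc_output o)); split=> //.
  apply: exec_seq; first exact: ev_assign.
  by apply: exec_seq E _; rewrite -s3; apply: ev_assign.
apply: leq_trans (leq_pow_affine _ _); apply: leq_trans (hc (n, m)) => /=.
have h1 : m * alph (S n) ^ arity (S n) <= (n + m) * b by apply: leq_mul; rewrite ?leq_addl.
have : (m * alph (S n) ^ arity (S n)).+1 * (T (n, m) + 6) <= ((n + m) * b).+1 * (T (n, m) + 6).
  by rewrite leq_mul2r ltnS h1 orbT.
by rewrite [((n + m) * b).+1 * _]mulSn; lia.
Qed.

(** * Size of histories, and solvers given as polynomial time functions *)

Lemma dsize_seq_le C `{encodable C} (l : seq C) M :
  (forall l1 y l2, l = l1 ++ y :: l2 -> dsize y <= M) -> dsize l <= size l * M.+1 + 1.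
Proof.
elim: l => // y l IH hM; rewrite dsize_cons /= mulSn.
have h1 := hM [::] y l erefl.
have h2 := IH (fun l1 z l2 e => hM (y :: l1) z l2 (congr1 (cons y) e)).
by lia.
Qed.

Lemma dsize_tuple_data k w (a : k.-tuple 'I_w) : dsize (tuple_data a) <= k * (2 * w).+2 + 1.
Proof.
rewrite -{2}(size_tuple a) -(size_map val a); apply: dsize_seq_le => l1 y l2 E.
have /mapP[i _ ->] : y \in tuple_data a by rewrite E mem_cat mem_head orbT.
by rewrite dsize_nat /=; have := ltn_ord i; lia.
Qed.

(** Distinct keys limit the number of entries, so a solver that is polynomial in the size of its
    input is polynomial in [n + m]. Alphabet and arity must be bounded by a constant, since they
    enter through a power. *)
Lemma pbounded_history (S : csp) (b : nat) (L : nat -> nat) :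
  (forall n, [/\ alph (S n) <= b, arity (S n) <= b & len (S n) <= L n]) ->
  pbounded id L ->
  exists2 W, pbounded (fun x : nat * nat => x.1 + x.2) W &
    forall n m (h : seq (entry (S n) m)), uniq (map (@entry_key _ _) h) ->
    dsize (params (S n) m n, map (@entry_data _ _) h) <= W (n, m).
Proof.
move=> hS [c hL].
pose N := fun x : nat * nat => x.1 + x.2.
pose l := fun x : nat * nat => L x.1.
have pn : pbounded N fst by apply: (pbounded_le (pbounded_id _)) => x; apply: leq_addr.
have pm : pbounded N snd by apply: (pbounded_le (pbounded_id _)) => x; apply: leq_addl.
have pl : pbounded N l.
  by apply: (pbounded_comp pn); exists c => x; apply: hL.
pose e := fun x : nat * nat =>
  l x * (2 * b).+2 + 1 + ((2 * x.2).+1 + (b * (2 * l x).+2 + 1)).+1.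
(* The constant 13 consists of 11 for the list cells and unit terms of the five parameters, 1 for
   the end of the history and 1 for the pair; [4 * b] covers alphabet and arity. *)
pose W := fun x : nat * nat =>
  2 * x.1 + 2 * x.2 + 2 * l x + 4 * b + 13 + x.2 * b.+1 ^ b * (e x).+2.
have pe : pbounded N e.
  repeat (first [exact: pn | exact: pm | exact: pl | exact: pbounded_const
    | apply: pbounded_add | apply: pbounded_mul | apply: pbounded_S ]).
exists W.
  repeat (first [exact: pn | exact: pm | exact: pl | exact: pe | exact: pbounded_const
    | apply: pbounded_add | apply: pbounded_mul | apply: pbounded_S ]).
move=> n m h uh; have [ha hr hl] := hS n.
have sh : size h <= m * b.+1 ^ b.
  apply: leq_trans (size_uniq_keys uh) _; rewrite leq_mul2l; apply/orP; right.
  apply: (@leq_trans (b.+1 ^ arity (S n))); last by rewrite leq_pexp2l.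
  by case: (arity (S n)) => // k; rewrite leq_exp2r // ltnW.
have he (y : entry (S n) m) : dsize (entry_data y) <= (e (n, m)).+1.
  rewrite !dsize_pair dsize_nat ltnS /e leq_add // ?ltnS.
    apply: leq_trans (dsize_tuple_data _) _.
    by rewrite leq_add2r leq_mul // !ltnS leq_mul2l.
  rewrite leq_add //; first by have := ltn_ord y.2.1; rewrite /=; lia.
  apply: leq_trans (dsize_tuple_data _) _.
  by rewrite leq_add2r leq_mul // !ltnS leq_mul2l.
have hh : dsize (map (@entry_data _ _) h) <= m * b.+1 ^ b * (e (n, m)).+2 + 1.
  apply: leq_trans (dsize_seq_le (M := (e (n, m)).+1) _) _.
    move=> l1 y l2 E.
    have /mapP[z _ ->] : y \in map (@entry_data _ _) h by rewrite E mem_cat mem_head orbT.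
    exact: he.
  by rewrite size_map leq_add2r leq_mul.
rewrite dsize_pair /W /=; set X := _ * (e (n, m)).+2 in hh *.
have -> : dsize (params (S n) m n) =
   2 * n + 2 * m + 2 * alph (S n) + 2 * len (S n) + 2 * arity (S n) + 11.
  have h0 : dsize ([::] : seq nat) = 1 by [].
  by rewrite /params !dsize_cons !dsize_nat h0; lia.
by rewrite /l /=; lia.
Qed.

(** The type [entry] varies with [n] and [m], but one program must serve them all; therefore [f]
    acts on raw lists of numbers and is constrained only on those that encode valid histories. *)
Lemma hidden_of_ptime (S : csp) (b : nat) (L : nat -> nat)
    (f : seq nat * seq (seq nat * (nat * seq nat)) -> option (seq nat)) :
  (forall n, [/\ alph (S n) <= b, arity (S n) <= b & len (S n) <= L n]) ->
  pbounded id L -> ptime f ->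
  (forall n m (I : m.-tuple (constraint (S n))) (h : seq (entry (S n) m)),
    is_instance I -> valid_history I h ->
    exists2 o, f (params (S n) m n, map (@entry_data _ _) h) = omap (@tuple_data _ _) o
      & good I h o) ->
  hidden_poly_solvable S.
Proof.
move=> hS pL [P [tm [P1 [c P2] _]]] hf.
have [W pW hW] := pbounded_history hS pL.
apply: (@hidden_poly_solvableI S P (b.+1 ^ b) (fun x => (W x).+2 ^ c)).
- move=> n; have [ha hr _] := hS n.
  apply: (@leq_trans (b.+1 ^ arity (S n))); last by rewrite leq_pexp2l.
  by case: (arity (S n)) => // k; rewrite leq_exp2r // ltnW.
- by apply: pbounded_comp pW _; exists c.
move=> n m I inst h vh uh; have [o fo go] := hf n m I h inst vh.
exists o; eexists; split; [|exact: go|].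
  have -> : enc_output o = enc (f (params (S n) m n, map (@entry_data _ _) h)).
    by rewrite fo; case: (o) => // a; rewrite /enc_output /= -enc_tuple_data.
  exact: P1.
apply: leq_trans (P2 _) _; have := hW n m h uh.
by case: (c) => // c' hw; rewrite leq_exp2r.
Qed.

(** * Graph properties *)

(** Under [no_oracle] every query blocks, so a terminating execution contains none and can be
    replayed with any oracle and query count. *)
Lemma exec_no_oracle O k s p k' s' t k0 :
  exec no_oracle k s p k' s' t -> exec O k0 s p k0 s' t.
Proof.
move=> E; elim: {k s p k' s' t} E k0.
- by move=> *; constructor.
- by move=> *; apply: exec_seq; eauto.
- by move=> *; apply: exec_if; eauto.
- by move=> *; apply: exec_while_stop.
- by move=> *; apply: exec_while_step; eauto.
- by move=> *; apply: exec_call; eauto.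
- by [].
Qed.

Lemma valid_historyP S m (I : m.-tuple (constraint S)) h :
  valid_history I h -> forall e, e \in h -> valid_entry I e.
Proof. by elim: h => //= e h IH [ve vh] e'; rewrite inE => /predU1P[->|/(IH vh)]. Qed.

Lemma compatibleP S m (h : seq (entry S m)) a :
  (forall e, e \in h ->
    [tuple of [seq tnth a i | i <- e.2.2]] <> (entry_key e).2) -> compatible h a.
Proof.
elim: h => //= e h IH ch; split; first by apply: ch; rewrite mem_head.
by apply: IH => e' e'h; apply: ch; rewrite inE e'h orbT.
Qed.

Lemma notin_Neg (x : 1.-tuple 'I_2) : x \notin Neg -> x = [tuple ord_max].
Proof.
rewrite inE => nx; apply: eq_from_tnth => i; rewrite ord1 tnth0.
case: (tnth x ord0 =P ord0) => [x0|]; last first.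
  by case: (tnth x ord0) => -[|[|k]] lt // x0; [case: x0|]; apply: val_inj.
case/eqP: nx; apply: eq_from_tnth => j; rewrite ord1 tnth0 x0.
by [].
Qed.

(** The input expected by a solver of S_P: [m] is replaced by the number of exclusions, 2 and 1 are
    alphabet size and arity, and each relation has index 0 because [Neg] is the only one. *)
Definition learned_input (w : seq nat * seq (seq nat * (nat * seq nat))) : seq tree :=
  [:: enc (nth 0 w.1 0); enc (size w.2); enc 2; enc (nth 0 w.1 3); enc 1;
      enc [seq (0, e.2.2) | e <- w.2]].

Lemma ptime_learned_input : ptime learned_input.
Proof. by rewrite /learned_input; ptime_auto. Qed.

Section Learned.
Variables (W : property) (n m : nat).
Let S := graph_csp W [:: Neg] n.
Variables (I : m.-tuple (constraint S)) (h : seq (entry S m)).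
Hypotheses (inst : is_instance I) (vh : valid_history I h)
  (uh : uniq (map (@entry_key _ _) h)).

Definition learned_instance : (size h).-tuple (constraint S) :=
  [tuple of [seq (Neg, e.2.2) : constraint S | e <- in_tuple h]].

Lemma tnth_Neg j : (tnth I j).1 = Neg.
Proof.
have /andP[/allP wI _] := inst.
have /andP[] := wI _ (mem_tnth j I).
by rewrite mem_seq1 => /eqP.
Qed.

Lemma learned_tnth e : e \in h -> tnth I e.2.1 = (Neg, e.2.2).
Proof.
move=> /(valid_historyP vh)[_ _ ->].
by rewrite [LHS]surjective_pairing tnth_Neg.
Qed.

Lemma learned_key e : e \in h -> (entry_key e).2 \notin Neg.
Proof.
move=> eh; have [_ + _] := valid_historyP vh eh.
by rewrite (learned_tnth eh).
Qed.

(** All keys carry the same local assignment, namely the value 1, so distinct keys mean distinct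
    constraint numbers, and these denote distinct constraints because [I] has no repetitions. *)
Lemma is_instance_learned : is_instance learned_instance.
Proof.
apply/andP; split.
  apply/allP => _ /mapP[e _ ->]; apply/andP; split; first by rewrite mem_head.
  by case: (e.2.2) => -[|x []].
have /andP[_ uI] := inst.
have -> : val learned_instance = [seq tnth I e.2.1 | e <- h].
  by apply/eq_in_map => e eh; rewrite learned_tnth.
rewrite (map_comp (tnth I)) map_inj_uniq; last exact/tuple_uniqP.
have ek : map (@entry_key _ _) h = [seq (e.2.1, [tuple ord_max]) | e <- h].
  apply/eq_in_map => e eh; rewrite [LHS]surjective_pairing.
  by rewrite [(entry_key e).2](notin_Neg (learned_key eh)).
move: uh; rewrite ek (map_comp (fun j => (j, [tuple ord_max]))).
by rewrite map_inj_uniq // => i j [].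
Qed.

Lemma good_learned o : correct_output learned_instance o -> good I h o.
Proof.
case: o => [a [ada /allP sa]|no].
  split=> //; apply: compatibleP => e eh E; have := learned_key eh.
  by rewrite -E; apply/negP; rewrite negbK; apply: (sa (Neg, e.2.2)); apply/mapP; exists e.
move=> a [ada /allP sa]; apply: (no a); split=> //; apply/allP => _ /mapP[e eh ->].
by rewrite -(learned_tnth eh); apply: sa; apply: mem_tnth.
Qed.

Lemma enc_learned_input :
  enc (learned_input (params S m n, map (@entry_data _ _) h)) =
  enc_seq (rcons (enc_params S n (size h)) (enc_instance learned_instance)).
Proof.
rewrite /learned_input /enc_params /= size_map.
have -> // : enc [seq (0, e.2.2) | e <- map (@entry_data _ _) h] = enc_instance learned_instance.
rewrite /enc /encodable_seq /enc_instance -!map_comp; congr enc_seq.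
apply: eq_map => e; rewrite /= /enc_constraint /= eqxx -enc_tuple_data.
by [].
Qed.

End Learned.

Lemma bin2_le_sqr n : 'C(n, 2) <= n * n.
Proof. by rewrite bin2 -divn2 (leq_trans (leq_div _ _)) // leq_mul2l leq_pred orbT. Qed.

(** The given program is specified on encoded instances only, so it does not yield a [ptime]
    function; it is composed by hand with the translation of the history. *)
Lemma hidden_graph_csp (W : property) :
  poly_solvable (graph_csp W [:: Neg]) -> hidden_poly_solvable (graph_csp W [:: Neg]).
Proof.
move=> [p [c [d hp]]]; set S := graph_csp W [:: Neg].
have hS n : [/\ alph (S n) <= 2, arity (S n) <= 2 & len (S n) <= n * n].
  by split=> //; apply: bin2_le_sqr.
have pL : pbounded id (fun n => n * n) by apply: pbounded_mul; apply: pbounded_id.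
have [Wh pW hW] := pbounded_history hS pL.
have [q [tq [q1 [cq q2] _]]] := ptime_learned_input.
(* The factor 2 comes from the general bound of [m * 2] keys on the size of the history. *)
pose T x := ((Wh x).+2 ^ cq).+1 + (c * (2 * (x.1 + x.2)) ^ d + c).+1.
apply: (@hidden_poly_solvableI S (Seq (Call 0 q (EVar 0)) (Call 0 p (EVar 0))) 2 T).
- by [].
- have pc := @pbounded_const _ (fun x : nat * nat => x.1 + x.2).
  apply: pbounded_add; apply: pbounded_S.
    by apply: pbounded_comp pW _; exists cq.
  apply: pbounded_add => //; apply: pbounded_mul => //.
  apply: (@pbounded_comp _ _ (fun x => 2 * (x.1 + x.2))).
    by apply: pbounded_mul => //; apply: pbounded_id.
  by exists d => x; case: (d) => // d'; rewrite leq_exp2r //; lia.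
move=> n m I inst h vh uh.
have sh := size_uniq_keys uh; rewrite /= expn1 in sh.
have [o [tp [[k [s [E s0]]] co tT]]] := hp n _ _ (is_instance_learned inst vh uh).
exists o, ((tq (params (S n) m n, map (@entry_data _ _) h)).+1 + tp.+1).
split; last 1 first.
- apply: leq_add; rewrite ltnS.
    apply: leq_trans (q2 _) _; have := hW n m h uh.
    by case: (cq) => // c' hw; rewrite leq_exp2r.
  apply: leq_trans tT _; rewrite leq_add2r leq_mul2l; apply/orP; right.
  case: (d) => // d'; rewrite leq_exp2r //= mulnDr leq_add // ?leq_pmull // mulnC; apply: sh.
- eexists; first (apply: ev_seq; apply: ev_call; first exact: q1).
    exists s; last exact: s0.
    move=> O k0; rewrite /= enc_learned_input; apply: exec_no_oracle E.
  by [].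
exact: (@good_learned W n m I h inst vh o co).
Qed.

(** * Two-satisfiability *)

Lemma ptime_eqb : ptime (fun w : bool * bool => w.1 == w.2).
Proof.
apply: (ptime_ext (f := fun w : bool * bool => if w.1 then w.2 else ~~ w.2)).
  by case=> [[] []].
by ptime_auto.
Qed.

Ltac ptime_eq ::= first
  [ exact: ptime_eqn | exact: ptime_eqb | apply: ptime_eq_pair; ptime_eq | eassumption ].

Definition literal : eqType := (nat * bool)%type.
Definition negl (l : literal) : literal := (l.1, ~~ l.2).

Lemma neglK : involutive negl.
Proof. by case=> v b; rewrite /negl negbK. Qed.

Section TwoSat.
Variables (L : nat) (K : seq (literal * literal)).

Definition literals : seq literal :=
  [seq (v, true) | v <- iota 0 L] ++ [seq (v, false) | v <- iota 0 L].

(** An element of [K] is a forbidden conjunction, that is, a clause made of the two negated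
    literals; its two implications are contrapositive to each other. *)
Definition implications : seq (literal * literal) :=
  [seq (k.1, negl k.2) | k <- K] ++ [seq (k.2, negl k.1) | k <- K].

(* [l] conflicts with [l'] when [l] implies the negation of [l']. *)
Definition consistent (l : literal) (s : seq literal) : bool :=
  all (fun l' => ~~ (negl l' \in reach literals implications l)) (l :: s).

Definition greedy_step (s : seq literal) (v : nat) : seq literal :=
  (if consistent (v, true) s then (v, true) else (v, false)) :: s.

Definition greedy : seq literal := foldl greedy_step [::] (iota 0 L).

(** [greedy_step] falls back on [false] unchecked. The final test makes any returned assignment
    sound, so it remains to show that the test succeeds on satisfiable formulas. *)
Definition solve2 : option (seq nat) :=
  let g := greedy in
  if all (fun k => ~~ ((k.1 \in g) && (k.2 \in g))) K
  then Some [seq (if (v, true) \in g then 1 else 0) | v <- iota 0 L] else None.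

Lemma mem_literals l : (l \in literals) = (l.1 < L).
Proof.
rewrite mem_cat; case: l => v b; apply/orP/idP.
  by case=> /mapP[u]; rewrite mem_iota => /= uL [-> _].
by move=> /= vL; case: b; [left | right]; apply: map_f; rewrite mem_iota.
Qed.

Lemma greedyE :
  exists f : nat -> bool, forall v b, ((v, b) \in greedy) = (v < L) && (f v == b).
Proof.
have [f Ef] : exists f : nat -> bool, greedy = rev [seq (v, f v) | v <- iota 0 L].
  rewrite /greedy; elim/last_ind: (iota 0 L) (iota_uniq 0 L) => [|s u IH].
    by exists (fun=> true).
  rewrite rcons_uniq => /andP[us /IH[f Ef]].
  exists (fun v => if v == u then consistent (u, true) (foldl greedy_step [::] s) else f v).
  rewrite foldl_rcons map_rcons rev_rcons eqxx {1}/greedy_step.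
  congr (_ :: _); first by case: ifP.
  rewrite Ef; congr rev; apply/eq_in_map => v vs.
  by case: eqP => // E; rewrite -E vs in us.
exists f => v b; rewrite Ef mem_rev; apply/mapP/andP.
  by case=> u; rewrite mem_iota => /= uL [-> ->].
by case=> vL /eqP <-; exists v; rewrite ?mem_iota.
Qed.

Hypothesis wfK : forall k, k \in K -> k.1.1 < L /\ k.2.1 < L.

Lemma implication_neg a b :
  (a, b) \in implications -> (negl b, negl a) \in implications.
Proof.
rewrite /implications !mem_cat => /orP[/mapP[k kK [-> ->]]|/mapP[k kK [-> ->]]];
  apply/orP; [right | left]; apply/mapP; exists k => //; by rewrite neglK.
Qed.

Lemma implication_wf a b : (a, b) \in implications -> b \in literals.
Proof.
rewrite mem_literals mem_cat => /orP[/mapP[k /wfK[? ?] [_ ->]]|/mapP[k /wfK[? ?] [_ ->]]] //.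
Qed.

Definition implies a b := b \in reach literals implications a.

Lemma impliesP a b : a.1 < L ->
  reflect (exists2 p, path (edge_rel implications) a p & last a p = b) (implies a b).
Proof. by rewrite -mem_literals => wa; apply: mem_reach => // x y /implication_wf. Qed.

Lemma implies_wf a b : a.1 < L -> implies a b -> b.1 < L.
Proof.
move=> wa /(impliesP _ wa)[p pp <-]; elim: p a wa pp => //= b' p IH a wa /andP[ab pp].
by apply: IH pp; rewrite -mem_literals; apply: implication_wf ab.
Qed.

Lemma implies_trans a b c : a.1 < L -> implies a b -> implies b c -> implies a c.
Proof.
move=> wa iab ibc; have wb := implies_wf wa iab.
move/(impliesP _ wa): iab => [p pp lp]; move/(impliesP _ wb): ibc => [q pq lq].
by apply/(impliesP _ wa); exists (p ++ q); rewrite ?last_cat ?cat_path lp // pp.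
Qed.

Lemma implies_edge a b : a.1 < L -> (a, b) \in implications -> implies a b.
Proof. by move=> wa ab; apply/(impliesP _ wa); exists [:: b] => //=; rewrite andbT. Qed.

Lemma implies_neg a b : a.1 < L -> implies a b -> implies (negl b) (negl a).
Proof.
move=> wa iab; have wb : (negl b).1 < L by apply: implies_wf iab.
move/(impliesP _ wa): iab wb => [p pp <-].
elim: p a wa pp => /= [|b' p IH] a wa => [_|/andP[ab pp]] wb.
  by apply/(@impliesP (negl a) _ wb); exists [::].
have wb' : b'.1 < L by rewrite -mem_literals; apply: implication_wf ab.
apply: (@implies_trans _ (negl b')); [exact: wb | exact: IH wb' pp wb |].
by apply: implies_edge; [exact: wb' | exact: implication_neg].
Qed.

Variable alpha : nat -> bool.
Hypothesis satK : forall k, k \in K -> ~~ ((alpha k.1.1 == k.1.2) && (alpha k.2.1 == k.2.2)).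

Lemma implies_sat a b : a.1 < L -> implies a b -> alpha a.1 = a.2 -> alpha b.1 = b.2.
Proof.
move=> wa /(impliesP _ wa)[p pp <-] {wa}; elim: p a pp => //= b' p IH a /andP[ab pp] sa.
apply: (IH _ pp); move: ab; rewrite /edge_rel mem_cat.
case/orP=> /mapP[k /satK + [Ea ->]]; rewrite Ea in sa; rewrite /= sa eqxx ?andbT /=.
  by case: (alpha _); case: (k.2.2).
by case: (alpha _); case: (k.1.2).
Qed.

Definition conflict_free (s : seq literal) :=
  {in s, forall l, l.1 < L} /\ {in s &, forall l l', ~~ implies l (negl l')}.

(** Testing what [l] implies is enough: by contraposition, a conflict of an old literal with [l] is
    also one of [l] with the old literal. *)
Lemma consistent_cons l s : l.1 < L -> consistent l s -> conflict_free s -> conflict_free (l :: s).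
Proof.
move=> wl /allP cl [ws cs]; split=> [x|x y]; rewrite !inE.
  by case/predU1P=> [->|/ws].
case/predU1P=> [->|xs]; first by move=> ys; apply: cl; rewrite inE.
case/predU1P=> [->|ys]; last exact: cs.
apply/negP => /(implies_neg (ws x xs)); rewrite neglK.
by apply/negP; apply: cl; rewrite inE xs orbT.
Qed.

(* Conflicts resolve: if [l] conflicts with [l1] and [negl l] with [l2], then
   [l1] conflicts with [l2].  So the greedy choice never gets stuck. *)
Lemma consistent_neg l s : l.1 < L -> ~~ consistent l s -> conflict_free s ->
  consistent (negl l) s.
Proof.
move=> wl /allPn[l1 l1s]; rewrite negbK -/(implies _ _) => i1 [ws cs].
have w1 : l1.1 < L by move: l1s; rewrite inE => /predU1P[->|/ws].
have i1' : implies l1 (negl l) by have := implies_neg wl i1; rewrite neglK.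
apply/allP => l2 l2s; rewrite -/(implies _ _); apply/negP => i2.
have i12 := implies_trans w1 i1' i2.
(* If [l1] is [l] and [l2] is its negation, then [l] and its negation imply each other; only here is
   the satisfying [alpha] used. In the other cases some literal of [s] implies its own negation or
   that of another one in [s]. *)
move: l2s l1s; rewrite !inE => /predU1P[E2|l2s] /predU1P[E1|l1s].
- move: i1' i2; rewrite E1 E2 neglK => i1' i2.
  case: (alpha l.1 =P l.2) => [al|/eqP nl].
    by have := implies_sat wl i1' al; rewrite /= al; case: (l.2).
  have /(implies_sat (b := l)) : alpha (negl l).1 = (negl l).2.
    by rewrite /=; move: nl; case: (alpha _); case: (l.2).
  by move=> /(_ wl i2) E; rewrite E eqxx in nl.
- move: i12; rewrite E2 neglK => i12.
  by have := cs _ _ l1s l1s; rewrite (implies_trans w1 i12 i1).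
- have i3 : implies l2 (negl l).
    by have := implies_neg w1 i12; rewrite E1 neglK.
  by have := cs _ _ l2s l2s; rewrite (implies_trans (ws _ l2s) i3 i2).
- by have := cs _ _ l1s l2s; rewrite i12.
Qed.

(** A violated element of [K] would put both of its literals into the greedy set, although the first
    implies the negation of the second. *)
Lemma solve2_complete : solve2 != None.
Proof.
rewrite /solve2; have [_ cg] : conflict_free greedy.
  rewrite /greedy; have: forall v, v \in iota 0 L -> v < L by move=> v; rewrite mem_iota.
  elim/last_ind: (iota 0 L) => // s v IH sub; rewrite foldl_rcons /greedy_step.
  have {}IH : conflict_free (foldl greedy_step [::] s).
    by apply: IH => u us; apply: sub; rewrite mem_rcons inE us orbT.
  have vL : v < L by apply: sub; rewrite mem_rcons mem_head.
  case: ifP => [|/negbT] cv; first exact: consistent_cons.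
  apply: consistent_cons => //.
  exact: (consistent_neg (l := (v, true))).
rewrite ifT //; apply/allP => k kK; apply/negP => /andP[k1 k2].
have /negP := cg _ _ k1 k2; apply; apply: implies_edge; first by case: (wfK kK).
by rewrite mem_cat map_f.
Qed.

End TwoSat.

(** * Running time of the 2-SAT solver, and its use on histories *)

Lemma ptime_consistent A `{encodable A} (L : A -> nat)
    (K : A -> seq (literal * literal)) (l : A -> literal) (s : A -> seq literal) :
  ptime L -> ptime K -> ptime l -> ptime s ->
  ptime (fun x => consistent (L x) (K x) (l x) (s x)).
Proof.
move=> pL pK pl ps; rewrite /consistent; ptime_auto; first by rewrite /negl; ptime_auto.
apply: ptime_reach; first by ptime_eq.
- by rewrite /literals; ptime_auto.
- by rewrite /implications /negl; ptime_auto.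
- by ptime_auto.
Qed.

Lemma ptime_greedy : ptime (fun w : nat * seq (literal * literal) => greedy w.1 w.2).
Proof.
rewrite /greedy.
(* A new literal adds the size of its variable, at most 3 for the Boolean, and one node each for the
   pair and the list cell. *)
apply: (ptime_foldl_add (h := fun w => dsize (iota 0 w.1) + 5)).
- rewrite /greedy_step; ptime_auto; apply: ptime_consistent; ptime_auto.
- by ptime_auto.
- by ptime_auto.
- apply: pbounded_add (pbounded_const _ _).
  have pi : ptime (fun w : nat * seq (literal * literal) => iota 0 w.1) by ptime_auto.
  by have [_ [_ [_ _ b]]] := pi.
move=> [L K] a l1 v l2 /= E.
have hv : dsize v <= dsize (iota 0 L) by rewrite E dsize_mem_cat.
by rewrite /greedy_step; case: ifP => _; rewrite dsize_cons dsize_pair;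
  have := dsize_bool true; have := dsize_bool false; lia.
Qed.

Lemma ptime_solve2 : ptime (fun w : nat * seq (literal * literal) => solve2 w.1 w.2).
Proof.
have pg := ptime_greedy; rewrite /solve2; ptime_auto.
all: by apply: (ptime_comp2 pg); ptime_auto.
Qed.

(** The two literals that the rejected query made true on the reported variables; they must not hold
    together again. *)
Definition entry_nogood (e : seq nat * (nat * seq nat)) : literal * literal :=
  let x := nth 0 e.2.2 0 in let y := nth 0 e.2.2 1 in
  ((x, nth 0 e.1 x == 1), (y, nth 0 e.1 y == 1)).

Definition solve2_history (w : seq nat * seq (seq nat * (nat * seq nat))) :=
  solve2 (nth 0 w.1 0) [seq entry_nogood e | e <- w.2].

Lemma ptime_solve2_history : ptime solve2_history.
Proof.
rewrite /solve2_history; apply: (ptime_comp2 ptime_solve2); first by ptime_auto.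
by rewrite /entry_nogood; ptime_auto.
Qed.

Definition binary_csp (R : nat -> seq {set 2.-tuple 'I_2}) : csp := fun n =>
  @CSPAt 2 n 2 (fun=> True) (R n).

Lemma nth_tuple_data k w (a : k.-tuple 'I_w) (i : 'I_k) :
  nth 0 (tuple_data a) i = tnth a i.
Proof.
rewrite (nth_map (tnth a i)) ?size_tuple //; congr val.
by rewrite -tnth_nth.
Qed.

Lemma eq_bit (x y : 'I_2) : (x == y) = ((x == 1 :> nat) == (y == 1 :> nat)).
Proof. by case: x y => -[|[|x]] // ? [[|[|y]] ?]. Qed.

Section BinaryCsp.
Variables (R : nat -> seq {set 2.-tuple 'I_2}) (n m : nat).
Let S := binary_csp R n.
Variables (I : m.-tuple (constraint S)) (h : seq (entry S m)).
Hypothesis vh : valid_history I h.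

Lemma entry_nogoodE (e : entry S m) : entry_nogood (entry_data e) =
  let x := tnth e.2.2 ord0 in let y := tnth e.2.2 ord_max in
  ((val x, tnth e.1 x == 1 :> nat), (val y, tnth e.1 y == 1 :> nat)).
Proof.
rewrite /entry_nogood /entry_data /=.
have E0 : nth 0 (tuple_data e.2.2) 0 = tnth e.2.2 ord0 := nth_tuple_data e.2.2 ord0.
have E1 : nth 0 (tuple_data e.2.2) 1 = tnth e.2.2 ord_max := nth_tuple_data e.2.2 ord_max.
by rewrite E0 E1 !nth_tuple_data.
Qed.

Lemma nogoodP (e : entry S m) (a : assignment S) (k := entry_nogood (entry_data e)) :
  ([tuple of [seq tnth a i | i <- e.2.2]] == (entry_key e).2) =
  ((nth 0 (tuple_data a) k.1.1 == 1) == k.1.2) && ((nth 0 (tuple_data a) k.2.1 == 1) == k.2.2).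
Proof.
rewrite /k entry_nogoodE /= !nth_tuple_data -!eq_bit.
apply/eqP/andP => [E|[/eqP E0 /eqP E1]].
  have E0 := congr1 (fun t => tnth t ord0) E; have E1 := congr1 (fun t => tnth t ord_max) E.
  by rewrite !tnth_map in E0 E1; rewrite E0 E1.
apply: eq_from_tnth => i; rewrite !tnth_map.
by case: i => -[|[|i]] // lti; [have -> : Ordinal lti = ord0 | have -> : Ordinal lti = ord_max];
  rewrite //; apply: val_inj.
Qed.

Lemma nogood_wf (e : entry S m) :
  (entry_nogood (entry_data e)).1.1 < n /\ (entry_nogood (entry_data e)).2.1 < n.
Proof. by rewrite entry_nogoodE /=; split; apply: ltn_ord. Qed.

Lemma solve2_history_good :
  exists2 o, solve2_history (params S m n, map (@entry_data _ _) h) = omap (@tuple_data _ _) o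
    & good I h o.
Proof.
rewrite /solve2_history /=; set K := [seq entry_nogood e | e <- _].
have KP k : reflect (exists2 e, e \in h & k = entry_nogood (entry_data e)) (k \in K).
  apply: (iffP mapP) => [[_ /mapP[e eh ->] ->]|[e eh ->]]; first by exists e.
  by exists (entry_data e) => //; apply: map_f.
have wK k : k \in K -> k.1.1 < n /\ k.2.1 < n by case/KP=> e _ ->; apply: nogood_wf.
case E: (solve2 n K) => [a|].
  have [f gf] := greedyE n K.
  pose b : assignment S := [tuple (if f i then ord_max else ord0) | i < n].
  have bf v : v < n -> (nth 0 (tuple_data b) v == 1) = f v.
    move=> vn; rewrite (nth_tuple_data b (Ordinal vn)) tnth_mktuple /=.
    by case: (f v).
  move: E; rewrite /solve2; case: ifP => // /allP sK [<-]; exists (Some b) => /=.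
    congr Some; rewrite /tuple_data /= -map_comp -val_enum_ord -map_comp.
    by apply: eq_map => i /=; rewrite gf ltn_ord; case: (f i).
  split=> //; apply: compatibleP => e eh; apply/eqP; rewrite nogoodP.
  have kK : entry_nogood (entry_data e) \in K by apply/KP; exists e.
  have [w1 w2] := wK _ kK; rewrite !bf //.
  move: (sK _ kK); move: w1 w2; case: (entry_nogood _) => -[v1 b1] [v2 b2] /= w1 w2.
  by rewrite !gf w1 w2.
exists None => // a [_ /allP sa].
suff: solve2 n K != None by rewrite E.
apply: (solve2_complete wK (alpha := fun v => nth 0 (tuple_data a) v == 1)).
(* If a solution restricted to an excluded local assignment, it would violate the reported
   constraint just as the query did. *)
move=> _ /KP[e eh ->]; rewrite -nogoodP.
have [_ + ev] := valid_historyP vh eh; apply: contra => /eqP ea.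
by have := sa _ (mem_tnth e.2.1 I); rewrite /satisfies -ev ea.
Qed.

End BinaryCsp.

Lemma hidden_binary_csp (R : nat -> seq {set 2.-tuple 'I_2}) :
  hidden_poly_solvable (binary_csp R).
Proof.
apply: (@hidden_of_ptime _ 2 id _ _ _ ptime_solve2_history) => //.
  exact: pbounded_id.
by move=> n m I h _ vh; apply: solve2_history_good.
Qed.

(** * Spanning trees *)

Section Forests.
Variable T : eqType.
Implicit Types (F : seq (T * T)) (e : T * T).

Definition undirected F : seq (T * T) := F ++ [seq (e.2, e.1) | e <- F].

Definition adjacent F : rel T := edge_rel (undirected F).

Definition linked F x y : Prop := exists2 p, path (adjacent F) x p & last x p = y.

(** The bound is 2 because an edge run back and forth is a closed walk without repeated vertices. *)
Definition acyclic F : Prop := forall c, ucycle (adjacent F) c -> size c <= 2.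

(* Every edge is a bridge. *)
Definition forest F : Prop :=
  forall e, e \in F -> ~ linked [seq f <- F | f != e] e.1 e.2.

Lemma adjacentE F x y : adjacent F x y = ((x, y) \in F) || ((y, x) \in F).
Proof.
rewrite /adjacent /edge_rel mem_cat; congr orb.
apply/mapP/idP => [[[u v] uv [-> ->]] //|yx]; by exists (y, x).
Qed.

Lemma adjacent_sym F x y : adjacent F x y = adjacent F y x.
Proof. by rewrite !adjacentE orbC. Qed.

Lemma linked_refl F x : linked F x x.
Proof. by exists [::]. Qed.

Lemma linked_trans F x y z : linked F x y -> linked F y z -> linked F x z.
Proof.
move=> [p pp lp] [q pq lq]; exists (p ++ q); first by rewrite cat_path pp lp.
by rewrite last_cat lp.
Qed.

Lemma linked_adjacent F x y : adjacent F x y -> linked F x y.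
Proof. by move=> xy; exists [:: y] => //=; rewrite xy. Qed.

Lemma linked_sym F x y : linked F x y -> linked F y x.
Proof.
move=> [p pp <-] {y}; elim: p x pp => [|z p IH] x /=; first by move=> _; apply: linked_refl.
move=> /andP[xz /IH zp]; apply: linked_trans zp _.
by apply: linked_adjacent; rewrite adjacent_sym.
Qed.

Lemma linked_sub F F' x y :
  (forall e, e \in F -> linked F' e.1 e.2) -> linked F x y -> linked F' x y.
Proof.
move=> sub [p pp <-] {y}; elim: p x pp => [|z p IH] x /=; first by move=> _; apply: linked_refl.
move=> /andP[xz /IH]; apply: linked_trans; move: xz; rewrite adjacentE.
by case/orP=> /sub //=; apply: linked_sym.
Qed.

Lemma linked_mem F e : e \in F -> linked F e.1 e.2.
Proof. by case: e => x y eF; apply: linked_adjacent; rewrite adjacentE eF. Qed.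

(** A connection needs the new edge at most once, in one of its two directions. *)
Lemma linked_cons F e x y : linked (e :: F) x y ->
  [\/ linked F x y, linked F x e.1 /\ linked F e.2 y | linked F x e.2 /\ linked F e.1 y].
Proof.
move=> [p pp <-] {y}; elim: p x pp => [|z p IH] x /=.
  by move=> _; apply: Or31; apply: linked_refl.
move=> /andP[xz /IH {IH}]; move: (last z p) => y IH.
move: xz; rewrite adjacentE !inE => xz.
have {xz} [lxz|[ez ex]|[ez ex]] : [\/ linked F x z, e.1 = x /\ e.2 = z | e.1 = z /\ e.2 = x].
  case/orP: xz => /orP[/eqP <-|xz]; [exact: Or32| |exact: Or33|]; apply: Or31.
    exact: linked_mem xz.
  by apply: linked_sym; apply: linked_mem xz.
- case: IH => [lzy|[lz ly]|[lz ly]].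
  + by apply: Or31; apply: linked_trans lzy.
  + by apply: Or32; split=> //; apply: linked_trans lz.
  + by apply: Or33; split=> //; apply: linked_trans lz.
- case: IH; rewrite ez ex.
  + by move=> lzy; apply: Or32; split=> //; apply: linked_refl.
  + by case=> _ lzy; apply: Or32; split=> //; apply: linked_refl.
  + by case=> _ lxy; apply: Or31.
- case: IH; rewrite ez ex.
  + by move=> lzy; apply: Or33; split=> //; apply: linked_refl.
  + by case=> _ lxy; apply: Or31.
  + by case=> _ lzy; apply: Or33; split=> //; apply: linked_refl.
Qed.

(** If an old edge [f] ceased to be a bridge, the detour around it would use [e]; the rest of the
    detour together with [f] would then link the ends of [e] inside [F]. *)
Lemma forest_cons F e : forest F -> ~ linked F e.1 e.2 -> forest (e :: F).
Proof.
move=> fF ne f; rewrite inE; have [-> _|fe /= fF'] := eqVneq f e.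
  rewrite /= eqxx /= => le; apply: ne; apply: linked_sub le => g.
  by rewrite mem_filter => /andP[_ /linked_mem].
have sub x y : linked [seq g <- F | g != f] x y -> linked F x y.
  by apply: linked_sub => g; rewrite mem_filter => /andP[_ /linked_mem].
have lf := linked_mem fF'; rewrite eq_sym fe => /linked_cons[|[l1 l2]|[l1 l2]].
- exact: fF.
- apply: ne; apply: linked_trans (linked_sym (sub _ _ l1)) _.
  by apply: linked_trans lf _; apply: linked_sym; apply: sub.
- apply: ne; apply: linked_trans (sub _ _ l2) _.
  by apply: linked_trans (linked_sym lf) _; apply: sub.
Qed.

(** Otherwise a pair missing from a sublist could still be present there through its reverse, which
    would spoil [acyclic_bridge]. *)
Definition oriented F : Prop := forall x y, (x, y) \in F -> x != y /\ (y, x) \notin F.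

(** Bridges are what adding an edge preserves, cycles are what [spanning_tree] speaks of. On a cycle
    through [x], [y], [z], deleting the edge between [x] and [y] leaves the way from [y] to [z] and
    on to [x], which does not return to [y]. *)
Lemma forest_acyclic F : oriented F -> forest F -> acyclic F.
Proof.
move=> oF fF [|x [|y [|z r]]] //= /andP[/and3P[xy yz pzr] /andP[xn /andP[yn _]]].
exfalso; move: xn; rewrite !inE !negb_or => /and3P[nxy nxz xr].
have /fF : (if (x, y) \in F then (x, y) else (y, x)) \in F.
  by move: xy; rewrite adjacentE; case: ifP.
set e := if _ then _ else _.
have adj u v : u != y -> v != y -> adjacent F u v -> adjacent [seq f <- F | f != e] u v.
  move=> uy vy; rewrite !adjacentE !mem_filter /e.
  by case: ifP => _; rewrite !xpair_eqE (negbTE uy) (negbTE vy) ?andbF.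
have lyx : linked [seq f <- F | f != e] y x.
  apply: (linked_trans (y := z)).
    apply: linked_adjacent; move: yz; rewrite !adjacentE !mem_filter /e.
    have zx : z != x by rewrite eq_sym.
    have yx : y != x by rewrite eq_sym.
    by case: ifP => _; rewrite !xpair_eqE (negbTE yx) (negbTE zx) ?andbF ?orbF.
  exists (rcons r x); last by rewrite last_rcons.
  apply: (sub_in_path (P := [pred u | u != y])) pzr.
    by move=> u v /= uy vy; apply: adj.
  apply/allP => u.
  rewrite inE mem_rcons inE => uz; apply/eqP => uy; subst u.
  move: yn; rewrite inE negb_or => /andP[yz' yr].
  by rewrite (negbTE yz') (negbTE yr) eq_sym (negbTE nxy) in uz.
have Ee : e = (x, y) \/ e = (y, x) by rewrite /e; case: ifP; [left | right].
by apply; case: Ee lyx => -> lyx; [apply: linked_sym|]; apply: lyx.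
Qed.

Lemma acyclic_bridge G F e : oriented G -> acyclic G -> {subset F <= G} ->
  e \in G -> e \notin F -> ~ linked F e.1 e.2.
Proof.
case: e => x y /= oG aG FG eG eF [p pp lp].
have [nxy yxG] := oG _ _ eG.
move: pp lp => /shortenP[q pq uq _] lq {p}.
have pG : path (adjacent G) x q.
  by apply: sub_path pq => u v; rewrite !adjacentE => /orP[] /FG ->; rewrite ?orbT.
have /aG : ucycle (adjacent G) (x :: q).
  by rewrite /ucycle uq andbT /= rcons_path pG lq adjacentE eG orbT.
(* Closing the path by [e] gives a cycle of [G], so the path has at most one edge: with none, [e] is
   a loop; with one, [F] contains [e] or its reverse. *)
case: q pq lq {uq pG} => [_ /= xy|z [|//] /= /andP[xz _] zy _].
  by rewrite xy eqxx in nxy.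
subst z; move: xz; rewrite adjacentE (negbTE eF) /= => /FG.
by rewrite (negbTE yxG).
Qed.

End Forests.

(** * Kruskal's algorithm *)

Section Kruskal.
Variable T : eqType.
Implicit Types (V : seq T) (F G s : seq (T * T)).

Definition kruskal_step V F (e : T * T) : seq (T * T) :=
  if e.2 \in reach V (undirected F) e.1 then F else e :: F.

Definition kruskal V s : seq (T * T) := foldl (kruskal_step V) [::] s.

Definition within V s : Prop := forall x y, (x, y) \in s -> x \in V /\ y \in V.

Lemma linkedP V F x y : within V F -> x \in V ->
  reflect (linked F x y) (y \in reach V (undirected F) x).
Proof.
move=> wF xV; apply: mem_reach => // u v; rewrite mem_cat.
by case/orP=> [/wF[]//|/mapP[[a b] /wF[aV bV] [_ ->]]].
Qed.

Lemma kruskal_sub V s : {subset kruskal V s <= s}.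
Proof.
rewrite /kruskal; elim/last_ind: s => // s e IH f; rewrite foldl_rcons mem_rcons inE.
rewrite {1}/kruskal_step; case: ifP => _; first by move/IH ->; rewrite orbT.
by rewrite inE => /orP[->//|/IH ->]; rewrite orbT.
Qed.

Lemma kruskal_within V s : within V s -> within V (kruskal V s).
Proof. by move=> ws x y /kruskal_sub /ws. Qed.

Lemma within_rcons V s e : within V (rcons s e) -> within V s /\ e.1 \in V.
Proof.
move=> w; split=> [x y xs|]; first by apply: w; rewrite mem_rcons inE xs orbT.
by case: e w => x y /(_ x y); rewrite mem_rcons mem_head => /(_ isT)[].
Qed.

Lemma kruskal_rcons V s e : kruskal V (rcons s e) = kruskal_step V (kruskal V s) e.
Proof. exact: foldl_rcons. Qed.

Lemma kruskal_stepP V s e : within V (rcons s e) ->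
  kruskal V (rcons s e) = kruskal V s /\ linked (kruskal V s) e.1 e.2 \/
  kruskal V (rcons s e) = e :: kruskal V s /\ ~ linked (kruskal V s) e.1 e.2.
Proof.
case/within_rcons=> ws eV; rewrite kruskal_rcons /kruskal_step.
by case: (linkedP e.2 (kruskal_within ws) eV); [left | right].
Qed.

Lemma forest_kruskal V s : within V s -> forest (kruskal V s).
Proof.
elim/last_ind: s => [_ e //|s e IH] w; have [ws _] := within_rcons w.
case: (kruskal_stepP w) => -[->] // ne; first exact: IH.
by apply: forest_cons => //; apply: IH.
Qed.

(** An edge is either kept or rejected because its ends are already linked, and links persist. *)
Lemma linked_kruskal V s e : within V s -> e \in s -> linked (kruskal V s) e.1 e.2.
Proof.
elim/last_ind: s => // s f IH w; have [ws _] := within_rcons w.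
rewrite mem_rcons inE; case: (kruskal_stepP w) => -[->] lf.
  by case/predU1P=> [-> //|]; apply: IH.
case/predU1P=> [->|/(IH ws)]; first by apply: linked_mem; rewrite mem_head.
by apply: linked_sub => g gs; apply: linked_mem; rewrite inE gs orbT.
Qed.

Lemma kruskal_cat V s t : {subset kruskal V s <= kruskal V (s ++ t)}.
Proof.
elim/last_ind: t => [|t f IH] e eF; first by rewrite cats0.
rewrite -rcons_cat kruskal_rcons /kruskal_step.
by case: ifP => _; rewrite ?inE (IH _ eF) ?orbT.
Qed.

(** A rejected edge would close a cycle in [G] with accepted ones, so nothing is rejected. This is
    why the prescribed edges, offered first, all survive. *)
Lemma kruskal_acyclic V s G : within V s -> oriented G -> acyclic G -> {subset s <= G} ->
  {subset s <= kruskal V s}.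
Proof.
move=> + oG aG; elim/last_ind: s => // s f IH w sG; have [ws _] := within_rcons w.
have sG' : {subset s <= G} by move=> e es; apply: sG; rewrite mem_rcons inE es orbT.
have fG : f \in G by apply: sG; rewrite mem_rcons mem_head.
move=> e; rewrite mem_rcons inE; case: (kruskal_stepP w) => -[->] lf; last first.
  by rewrite inE => /orP[->//|/(IH ws sG') ->]; rewrite orbT.
case/predU1P=> [->|]; last exact: IH.
apply/negPn/negP => fF; apply: (acyclic_bridge oG aG _ fG fF lf).
by move=> g /kruskal_sub /sG'.
Qed.

Lemma kruskal_linked V s G x y : within V s -> {subset G <= s} ->
  linked G x y -> linked (kruskal V s) x y.
Proof. by move=> ws Gs; apply: linked_sub => e /Gs; apply: linked_kruskal. Qed.

End Kruskal.

(** * The numbering of edges, and the graph of an assignment *)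

Definition pairs (n : nat) : seq (nat * nat) :=
  flatten [seq [seq (i, j) | i <- iota 0 j] | j <- iota 0 n].

Lemma pairsS n : pairs n.+1 = pairs n ++ [seq (i, n) | i <- iota 0 n].
Proof. by rewrite /pairs -addn1 iotaD map_cat flatten_cat /= cats0. Qed.

Lemma size_pairs n : size (pairs n) = 'C(n, 2).
Proof. by elim: n => // n IH; rewrite pairsS size_cat IH size_map size_iota binS bin1. Qed.

Lemma mem_pairs n i j : ((i, j) \in pairs n) = (i < j < n).
Proof.
elim: n => [|n IH]; first by rewrite ltn0 andbF.
rewrite pairsS mem_cat IH; apply/orP/andP.
  case=> [/andP[-> /leqW]//|/mapP[k]]; rewrite mem_iota /= => kn [-> ->].
  by rewrite kn.
case=> ij; rewrite ltnS leq_eqVlt => /predU1P[jn|->]; last by left; rewrite ij.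
by right; rewrite jn; apply/mapP; exists i => //; rewrite mem_iota -jn.
Qed.

(** [pairs] lists the edges by their larger end first, so positions coincide with [edge_var]; this
    decodes a variable number into an edge. *)
Lemma edge_var_nth_pairs n v (e := nth (0, 0) (pairs n) v) : v < 'C(n, 2) ->
  e \in pairs n /\ edge_var e.1 e.2 = v.
Proof.
move=> vC; split; first by rewrite mem_nth // size_pairs.
rewrite /e {e}; elim: n vC => // n IH; rewrite pairsS nth_cat size_pairs.
move=> vC; case: ltnP => [lv|Cv]; first exact: IH.
have kn : v - 'C(n, 2) < n by move: vC; rewrite binS bin1; lia.
by rewrite (nth_map 0) ?size_iota // nth_iota //= /edge_var; lia.
Qed.

Lemma nth_pairs n i j : i < j -> j < n -> nth (0, 0) (pairs n) (edge_var i j) = (i, j).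
Proof.
move=> ij jn; have [] := edge_var_nth_pairs (edge_var_lt ij jn).
case: (nth _ _ _) => i' j'; rewrite mem_pairs => /andP[ij' jn'] /= E.
by have [-> ->] := edge_var_inj ij' ij E.
Qed.

Lemma oriented_pairs n F : {subset F <= pairs n} -> oriented F.
Proof.
move=> sF x y xy; have := sF _ xy; rewrite mem_pairs => /andP[lxy _].
split; first by rewrite neq_ltn lxy.
by apply/negP => /sF; rewrite mem_pairs => /andP[lyx _]; lia.
Qed.

Lemma within_pairs n F : {subset F <= pairs n} -> within (iota 0 n) F.
Proof. by move=> sF x y /sF; rewrite mem_pairs !mem_iota /= => ?; lia. Qed.

Section GraphOf.
Variables (n : nat) (a : 'C(n, 2).-tuple 'I_2).

Definition edges_of : seq (nat * nat) :=
  [seq e <- pairs n | nth 0 (tuple_data a) (edge_var e.1 e.2) == 1].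

Lemma mem_edges_of i j :
  ((i, j) \in edges_of) = (i < j < n) && (nth ord0 a (edge_var i j) == ord_max).
Proof.
rewrite mem_filter mem_pairs andbC; case E: (i < j < n) => //=; have /andP[ij jn] := E.
have vC := edge_var_lt ij jn.
by rewrite (nth_map ord0) ?size_tuple //; case: (nth _ _ _) => -[|[|]].
Qed.

Lemma adj_graph_of (i j : 'I_n) : adj (graph_of a) i j = adjacent edges_of i j.
Proof.
rewrite adjacentE !mem_edges_of /adj /graph_of; apply/imsetP/orP.
  case=> -[p q]; rewrite inE /= => /andP[pq apq] E.
  have : [|| (i == p) && (j == q) | (i == q) && (j == p)].
    have ip : i \in [set p; q] by rewrite -E set21.
    have jp : j \in [set p; q] by rewrite -E set22.
    have pi : p \in [set i; j] by rewrite E set21.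
    have qi : q \in [set i; j] by rewrite E set22.
    move: ip jp pi qi; rewrite !in_set2 ![p == _]eq_sym ![q == _]eq_sym.
    have /negbTE npq : p != q by rewrite neq_ltn pq.
    case: (i =P p) => [->|_] /=; rewrite ?npq ?orbF /=.
      by move=> _ _ _ ->.
    by move=> -> _ ->.
  by case/orP=> /andP[/eqP -> /eqP ->]; [left | right]; rewrite pq ltn_ord.
by case=> /andP[/andP[ij _] aij]; [exists (i, j) | exists (j, i)];
  rewrite ?inE /= ?ij //= setUC.
Qed.

Lemma edges_of_sub : {subset edges_of <= pairs n}.
Proof. by move=> e; rewrite mem_filter => /andP[]. Qed.

Lemma adjacent_lt x y : adjacent edges_of x y -> y < n.
Proof.
by rewrite adjacentE => /orP[] /edges_of_sub; rewrite mem_pairs; lia.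
Qed.

Lemma connect_graph_of (i j : 'I_n) :
  reflect (linked edges_of i j) (connect (adj (graph_of a)) i j).
Proof.
apply: (iffP idP) => [/connectP[p pp ->]|[p]].
  exists (map val p); last by rewrite last_map.
  by rewrite path_map; apply: sub_path pp => u v /=; rewrite adj_graph_of.
elim: p i => [|y p IH] i /= => [_ /val_inj ->|/andP[iy pp] lp]; first exact: connect0.
apply: (@connect_trans _ _ (Ordinal (adjacent_lt iy))); last exact: IH.
by apply: connect1; rewrite adj_graph_of.
Qed.

Lemma ucycle_graph_of :
  (forall c, ucycle (adj (graph_of a)) c -> size c <= 2) <-> acyclic edges_of.
Proof.
have E c : ucycle (adj (graph_of a)) c = ucycle (adjacent edges_of) (map val c).
  rewrite /ucycle map_inj_uniq; last exact: val_inj.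
  by rewrite cycle_map; congr andb; apply: eq_cycle => u v; rewrite /= adj_graph_of.
split=> ac c uc; last by rewrite -(size_map val); apply: ac; rewrite -E.
(* Each vertex of a cycle is adjacent to the next one and hence smaller than [n], so the cycle lifts
   to ordinals without loss. *)
have Ec : map val (pmap insub c : seq 'I_n) = c.
  rewrite pmap_filter; last by move=> x; apply: insubK.
  apply/all_filterP/allP => x xc.
  have : next c x < n by apply: adjacent_lt (next_cycle (ucycle_cycle uc) xc).
  have := next_cycle (ucycle_cycle uc) xc; rewrite adjacent_sym => /adjacent_lt xn _.
  by rewrite insubT.
by rewrite -Ec size_map; apply: ac; rewrite E Ec.
Qed.

Lemma spanning_tree_graph_of : spanning_tree (graph_of a) <->
  (forall i j, i < n -> j < n -> linked edges_of i j) /\ acyclic edges_of.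
Proof.
split=> [[cn /ucycle_graph_of ac]|[cn /ucycle_graph_of ac]]; split=> //.
  by move=> i j ni nj; apply/(connect_graph_of (Ordinal ni) (Ordinal nj)).
by move=> i j; apply/connect_graph_of; apply: cn.
Qed.

End GraphOf.

(** * Spanning trees with prescribed and forbidden edges *)

Section SpanningTreeSolver.
Variables (n : nat) (K : seq (nat * nat * bool)).

Definition candidate_tree : seq (nat * nat) :=
  kruskal (iota 0 n) ([seq e <- pairs n | (e, true) \in K] ++
                      [seq e <- pairs n | (e, false) \notin K]).

(** Acyclicity holds by construction, so only connectedness and the prescriptions are tested. *)
Definition solve_tree : option (seq nat) :=
  let F := candidate_tree in
  if all (fun x => all (fun y => y \in reach (iota 0 n) (undirected F) x) (iota 0 n))
         (iota 0 n) && all (fun k => (k.1 \in F) == k.2) K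
  then Some [seq (if e \in F then 1 else 0) | e <- pairs n] else None.

Lemma candidate_tree_sub : {subset candidate_tree <= pairs n}.
Proof. by move=> e /kruskal_sub; rewrite mem_cat !mem_filter => /orP[] /andP[]. Qed.

Lemma within_cat_pairs : within (iota 0 n)
  ([seq e <- pairs n | (e, true) \in K] ++ [seq e <- pairs n | (e, false) \notin K]).
Proof.
by apply: within_pairs => e; rewrite mem_cat !mem_filter => /orP[] /andP[].
Qed.

Lemma acyclic_candidate_tree : acyclic candidate_tree.
Proof.
apply: forest_acyclic; first exact: oriented_pairs candidate_tree_sub.
exact: forest_kruskal within_cat_pairs.
Qed.

Lemma connected_candidate_tree :
  reflect (forall x y, x < n -> y < n -> linked candidate_tree x y)
    (all (fun x => all (fun y => y \in reach (iota 0 n) (undirected candidate_tree) x)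
      (iota 0 n)) (iota 0 n)).
Proof.
have w : within (iota 0 n) candidate_tree by apply: within_pairs candidate_tree_sub.
have I x : (x \in iota 0 n) = (x < n) by rewrite mem_iota.
apply: (iffP allP) => [h x y xn yn|h x xV].
  have xV : x \in iota 0 n by rewrite I.
  by apply/(linkedP y w xV); apply: (allP (h x xV)); rewrite I.
by apply/allP => y yV; apply/(linkedP y w xV); apply: h; rewrite -I.
Qed.

(** [G] is any tree that meets the prescriptions. All its edges are offered, so the candidate is
    connected; the prescribed ones lie in the acyclic [G], so none is rejected; a forbidden one
    could be offered only as a prescribed one, which [G] rules out. *)
Lemma solve_tree_complete (G : seq (nat * nat)) :
  {subset G <= pairs n} -> acyclic G ->
  (forall x y, x < n -> y < n -> linked G x y) ->
  (forall k, k \in K -> k.1 \in pairs n /\ (k.1 \in G) = k.2) -> solve_tree != None.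
Proof.
move=> sG aG cG hK; rewrite /solve_tree.
have inA e : (e, true) \in K -> e \in G by move=> /hK[_].
have notB e : e \in G -> (e, false) \notin K.
  by move=> eG; apply/negP => /hK[_] /=; rewrite eG.
rewrite ifT //; apply/andP; split.
  apply/connected_candidate_tree => x y xn yn; apply: kruskal_linked (cG x y xn yn).
    exact: within_cat_pairs.
  move=> e eG; rewrite mem_cat !mem_filter (notB _ eG) (sG _ eG).
  by rewrite orbT.
apply/allP => -[e b] eK; have [/= ep eG] := hK _ eK; apply/eqP => /=.
case: b eK eG => eK eG; last first.
  apply/negbTE/negP => /kruskal_sub; rewrite mem_cat !mem_filter eK /=.
  by case/orP=> // /andP[/inA]; rewrite eG.
apply: kruskal_cat; apply: kruskal_acyclic aG _ _ _.
- by apply: within_pairs => f; rewrite mem_filter => /andP[].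
- exact: oriented_pairs sG.
- by move=> f; rewrite mem_filter => /andP[/inA].
by rewrite mem_filter eK.
Qed.

End SpanningTreeSolver.

Lemma ptime_pairs : ptime pairs.
Proof. by rewrite /pairs; ptime_auto. Qed.

Lemma ptime_undirected A `{encodable A} (F : A -> seq (nat * nat)) :
  ptime F -> ptime (fun x => undirected (F x)).
Proof. by move=> pF; rewrite /undirected; ptime_auto. Qed.

Lemma ptime_kruskal A `{encodable A} (n : A -> nat) (s : A -> seq (nat * nat)) :
  ptime n -> ptime s -> ptime (fun x => kruskal (iota 0 (n x)) (s x)).
Proof.
apply: (ptime_comp2 (h := fun n s => kruskal (iota 0 n) s)).
rewrite /kruskal; apply: (ptime_foldl_add (h := fun w => (dsize w).+1)).
- rewrite /kruskal_step; ptime_auto.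
  apply: ptime_reach; first (by ptime_eq); try by ptime_auto.
  by apply: ptime_undirected; ptime_auto.
- by ptime_auto.
- by ptime_auto.
- by apply: pbounded_S; apply: pbounded_id.
move=> {n s}[n s] a l1 e l2 /= E; have he : dsize e <= dsize s by rewrite E dsize_mem_cat.
rewrite /kruskal_step; case: ifP => _; first exact: leq_addr.
rewrite dsize_cons dsize_pair addnC ltn_add2l (leq_ltn_trans he) //.
by rewrite ltnW // !ltnS leq_addl.
Qed.

Lemma ptime_solve_tree :
  ptime (fun w : nat * seq (nat * nat * bool) => solve_tree w.1 w.2).
Proof.
have pp := ptime_pairs.
have pc : ptime (fun w : nat * seq (nat * nat * bool) => candidate_tree w.1 w.2).
  by rewrite /candidate_tree; apply: ptime_kruskal; ptime_auto.
rewrite /solve_tree; ptime_auto.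
apply: ptime_reach; first (by ptime_eq); try by ptime_auto.
by apply: ptime_undirected; ptime_auto.
Qed.

(** Excluding one value of a bit prescribes the other one, hence the inequality. *)
Definition entry_edge (n : nat) (e : seq nat * (nat * seq nat)) : nat * nat * bool :=
  (nth (0, 0) (pairs n) (nth 0 e.2.2 0), nth 0 e.1 (nth 0 e.2.2 0) != 1).

Definition solve_tree_history (w : seq nat * seq (seq nat * (nat * seq nat))) :=
  solve_tree (nth 0 w.1 0) [seq entry_edge (nth 0 w.1 0) e | e <- w.2].

Lemma ptime_solve_tree_history : ptime solve_tree_history.
Proof.
have pp := ptime_pairs.
rewrite /solve_tree_history; apply: (ptime_comp2 ptime_solve_tree); first by ptime_auto.
by rewrite /entry_edge; ptime_auto.
Qed.

Section SpanningTreeCsp.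
Variables (n m : nat).
Let S := EQ spanning_tree n.
Variables (I : m.-tuple (constraint S)) (h : seq (entry S m)).
Hypothesis vh : valid_history I h.

Lemma entry_edgeE (e : entry S m) : let k := entry_edge n (entry_data e) in
  [/\ k.1 \in pairs n, edge_var k.1.1 k.1.2 = tnth e.2.2 ord0 &
      k.2 = (nth 0 (tuple_data e.1) (tnth e.2.2 ord0) != 1)].
Proof.
have E0 : nth 0 (tuple_data e.2.2) 0 = tnth e.2.2 ord0 := nth_tuple_data e.2.2 ord0.
rewrite /entry_edge /entry_data /= E0.
by have [] := edge_var_nth_pairs (ltn_ord (tnth e.2.2 ord0)).
Qed.

Lemma entry_edgeP (e : entry S m) (a : assignment S) :
  ([tuple of [seq tnth a i | i <- e.2.2]] != (entry_key e).2) =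
  ((nth 0 (tuple_data a) (tnth e.2.2 ord0) == 1) == (entry_edge n (entry_data e)).2).
Proof.
have [_ _ ->] := entry_edgeE e; rewrite !nth_tuple_data.
have -> : ([tuple of [seq tnth a i | i <- e.2.2]] == (entry_key e).2) =
    (tnth a (tnth e.2.2 ord0) == tnth e.1 (tnth e.2.2 ord0)).
  apply/eqP/eqP => [E|E]; first by have := congr1 (fun t => tnth t ord0) E; rewrite !tnth_map.
  by apply: eq_from_tnth => i; rewrite ord1 !tnth_map.
by rewrite eq_bit; case: (_ == 1); case: (_ == 1).
Qed.

Lemma solve_tree_history_good :
  exists2 o, solve_tree_history (params S m n, map (@entry_data _ _) h) =
               omap (@tuple_data _ _) o
    & good I h o.
Proof.
rewrite /solve_tree_history /=; set K := [seq entry_edge n e | e <- _].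
have KP k : reflect (exists2 e, e \in h & k = entry_edge n (entry_data e)) (k \in K).
  apply: (iffP mapP) => [[_ /mapP[e eh ->] ->]|[e eh ->]]; first by exists e.
  by exists (entry_data e) => //; apply: map_f.
case E: (solve_tree n K) => [s|].
  pose F := candidate_tree n K.
  pose b : assignment S :=
    [tuple (if nth (0, 0) (pairs n) i \in F then ord_max else ord0) | i < 'C(n, 2)].
  have bE v : v < 'C(n, 2) ->
      nth 0 (tuple_data b) v = if nth (0, 0) (pairs n) v \in F then 1 else 0.
    move=> vC; rewrite (nth_tuple_data b (Ordinal vC)) tnth_mktuple /=.
    by case: ifP.
  have bF : edges_of b =i F.
    move=> [i j]; rewrite mem_filter mem_pairs; apply/andP/idP => /=.
      case=> + /andP[ij jn]; rewrite bE ?edge_var_lt // nth_pairs //.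
      by case: ifP.
    move=> eF; have := candidate_tree_sub eF; rewrite mem_pairs => /andP[ij jn].
    by rewrite bE ?edge_var_lt // nth_pairs // eF ij.
  have adjb : adjacent (edges_of b) =2 adjacent F by move=> x y; rewrite !adjacentE !bF.
  move: E; rewrite /solve_tree -/F.
  case: ifP => // /andP[/connected_candidate_tree cF /allP sK] [<-]; exists (Some b).
    congr Some; apply: (@eq_from_nth _ 0).
      by rewrite size_map size_pairs size_tuple.
    move=> v; rewrite size_map size_pairs => vC.
    by rewrite bE // (nth_map (0, 0)) ?size_pairs.
  split.
    apply/spanning_tree_graph_of; split.
      move=> i j ni nj; have [p pp lp] := cF i j ni nj; exists p => //.
      by rewrite (eq_path adjb).
    move=> c; rewrite /ucycle (eq_cycle adjb).
    exact: (@acyclic_candidate_tree n K).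
  apply: compatibleP => e eh; apply/eqP; rewrite entry_edgeP.
  have [ep ev _] := entry_edgeE e.
  have kK : entry_edge n (entry_data e) \in K by apply/KP; exists e.
  move/(_ _ kK): sK => /eqP <-; apply/eqP.
  rewrite -ev; case: (entry_edge _ _) ep {ev kK} => -[i j] x /=.
  rewrite mem_pairs => /andP[ij jn].
  by rewrite bE ?edge_var_lt // nth_pairs //; case: ifP.
exists None => // a [/spanning_tree_graph_of [ca aa] /allP sa].
(* The edges of a solution [a] serve as the tree: [a] cannot agree with an excluded value, since it
   would then violate the reported constraint. *)
suff: solve_tree n K != None by rewrite E.
apply: (solve_tree_complete (edges_of_sub (a := a)) aa ca) => _ /KP[e eh ->].
have [ep ev _] := entry_edgeE e; split=> //.
rewrite mem_filter ep andbT ev; apply/(@eqP bool); rewrite -entry_edgeP.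
have [_ + eI] := valid_historyP vh eh; apply: contra => /eqP ea.
by have := sa _ (mem_tnth e.2.1 I); rewrite /satisfies -eI ea.
Qed.

End SpanningTreeCsp.

Lemma hidden_spanning_tree : hidden_poly_solvable (EQ spanning_tree).
Proof.
apply: (@hidden_of_ptime _ 2 (fun n => n * n) _ _ _ ptime_solve_tree_history).
- by move=> n; split=> //; apply: bin2_le_sqr.
- by apply: pbounded_mul; apply: pbounded_id.
- by move=> n m I h _ vh; apply: solve_tree_history_good.
Qed.

Theorem theorem7 :
  [/\ hidden_poly_solvable two_sat,
      hidden_poly_solvable (unique_games 2),
      forall P : property, monotone_graph_property P ->
        (poly_solvable (S_fewest P) -> hidden_poly_solvable (S_fewest P)) /\
        (poly_solvable (S_minimal P) -> hidden_poly_solvable (S_minimal P))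
    & hidden_poly_solvable (EQ spanning_tree)].
Proof.
split.
(* Both 2-SAT and UG_2 are convertible with [binary_csp] at their own lists of relations. *)
- exact: (hidden_binary_csp (fun n => rels (two_sat n))).
- exact: (hidden_binary_csp (fun n => rels (unique_games 2 n))).
- by move=> P _; split; apply: hidden_graph_csp.
- exact: hidden_spanning_tree.
Qed.
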